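(* Let $k$ be an algebraically closed field and let $B=k\tilde Q/\tilde I$ be a cluster-tilted $k$-algebra. Then $\mathrm{HH}^1(B)=0$ if and only if $B$ is hereditary and its ordinary quiver $\tilde Q$ is a tree.
   Context: Algebras are basic, connected and finite-dimensional over $k$. A cluster-tilted algebra is the endomorphism algebra of a cluster-tilting object in the cluster category of a finite-dimensional hereditary $k$-algebra; equivalently, it is an algebra of the form $C\ltimes\mathrm{Ext}^2_C(DC,C)$ with $C$ a tilted algebra and $D=\mathrm{Hom}_k(-,k)$. $\mathrm{HH}^1(B)$ is the first Hochschild cohomology group of $B$ with coefficients in the $B$-$B$-bimodule $B$. A quiver is a tree if its underlying graph is a tree. *)

(* Defs.v *)
From HB Require Import structures.
From mathcomp Require Import all_boot all_order all_algebra all_field.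

Set Implicit Arguments.
Unset Strict Implicit.
Unset Printing Implicit Defensive.

Import GRing.Theory.
Local Open Scope ring_scope.

(* A finite-dimensional k-algebra is a [falgType k] (in particular nonzero).
   Modules are finite-dimensional right modules. *)

Record rmodule (k : fieldType) (A : falgType k) := RModule {
  rcarrier :> vectType k;
  ract : rcarrier -> A -> rcarrier;
  ract_linl : forall a : A, linear (ract^~ a);
  ract_linr : forall m : rcarrier, linear (ract m);
  ract1 : forall m, ract m 1 = m;
  ractA : forall m a b, ract (ract m a) b = ract m (a * b) }.

(* A k-bilinear A-A-bimodule: k acts centrally by construction. *)
Record bimodule (k : fieldType) (A : falgType k) := Bimodule {
  bi_right :> rmodule A;
  lact : A -> bi_right -> bi_right;
  lact_linl : forall m : bi_right, linear (lact^~ m);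
  lact_linr : forall a : A, linear (lact a);
  lact1 : forall m, lact 1 m = m;
  lactA : forall a b m, lact a (lact b m) = lact (a * b) m;
  lractA : forall a m b, ract (lact a m) b = lact a (ract m b) }.

Section Modules.

Variables (k : fieldType) (A : falgType k).
Implicit Types M N P : rmodule A.

Definition is_hom M N (f : 'Hom(M, N)) : Prop :=
  forall m a, f (ract m a) = ract (f m) a.

Definition is_iso M N : Prop :=
  exists2 f : 'Hom(M, N), is_hom f & bijective f.

Definition is_submodule M (U : {vspace M}) : Prop :=
  forall m a, m \in U -> ract m a \in U.

Section Submodule.
Variables (M : rmodule A) (U : {vspace M}) (hU : is_submodule U).

Definition sub_ract (u : subvs_of U) (a : A) : subvs_of U :=
  vsproj U (ract (vsval u) a).

Fact sub_ractE u a : vsval (sub_ract u a) = ract (vsval u) a.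
Proof. by rewrite /sub_ract vsprojK // hU // subvsP. Qed.

Fact sub_ract_linl a : linear (sub_ract^~ a).
Proof.
move=> c u v; apply: subvs_inj.
by cbv beta; rewrite sub_ractE !linearP /= !sub_ractE; apply: ract_linl.
Qed.

Fact sub_ract_linr u : linear (sub_ract u).
Proof.
by move=> c a b; apply: subvs_inj; rewrite linearP /= !sub_ractE ract_linr.
Qed.

Fact sub_ract1 u : sub_ract u 1 = u.
Proof. by apply: subvs_inj; rewrite sub_ractE ract1. Qed.

Fact sub_ractA u a b : sub_ract (sub_ract u a) b = sub_ract u (a * b).
Proof. by apply: subvs_inj; rewrite !sub_ractE ractA. Qed.

Definition submodule : rmodule A :=
  RModule sub_ract_linl sub_ract_linr sub_ract1 sub_ractA.

End Submodule.

Section Power.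
Variables (M : rmodule A) (n : nat).

Definition pow_ract (u : {ffun 'I_n -> M}) (a : A) : {ffun 'I_n -> M} :=
  [ffun i => ract (u i) a].

Fact pow_ract_linl a : linear (pow_ract^~ a).
Proof. by move=> c u v; apply/ffunP => i; rewrite !ffunE ract_linl. Qed.

Fact pow_ract_linr u : linear (pow_ract u).
Proof. by move=> c a b; apply/ffunP => i; rewrite !ffunE ract_linr. Qed.

Fact pow_ract1 u : pow_ract u 1 = u.
Proof. by apply/ffunP => i; rewrite ffunE ract1. Qed.

Fact pow_ractA u a b : pow_ract (pow_ract u a) b = pow_ract u (a * b).
Proof. by apply/ffunP => i; rewrite !ffunE ractA. Qed.

Definition power_module : rmodule A :=
  RModule pow_ract_linl pow_ract_linr pow_ract1 pow_ractA.

End Power.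

Definition projective P : Prop :=
  forall M N (g : 'Hom(M, N)) (f : 'Hom(P, N)),
    is_hom g -> limg g = fullv -> is_hom f ->
    exists2 h : 'Hom(P, M), is_hom h & (g \o h)%VF = f.

Definition hereditary : Prop :=
  forall P (U : {vspace P}) (hU : is_submodule U),
    projective P -> projective (submodule hU).

Definition short_exact M' M M'' (f : 'Hom(M', M)) (g : 'Hom(M, M'')) : Prop :=
  [/\ is_hom f, is_hom g, lker f = 0%VS, limg f = lker g & limg g = fullv].

(* M lies in add T: it is a direct summand of some T^n. *)
Definition in_add (T : rmodule A) M : Prop :=
  exists n (s : 'Hom(M, power_module T n)) (r : 'Hom(power_module T n, M)),
    [/\ is_hom s, is_hom r & (r \o s)%VF = \1%VF].

Definition proj_dim_le1 M : Prop :=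
  exists (P0 P1 : rmodule A) (f : 'Hom(P1, P0)) (g : 'Hom(P0, M)),
    [/\ projective P0, projective P1 & short_exact f g].

Record resolution M := Resolution {
  res :> nat -> rmodule A;
  res_d : forall n, 'Hom(res n.+1, res n);
  res_aug : 'Hom(res 0, M);
  res_proj : forall n, projective (res n);
  res_d_hom : forall n, is_hom (res_d n);
  res_aug_hom : is_hom res_aug;
  res_aug_surj : limg res_aug = fullv;
  res_exact0 : limg (res_d 0) = lker res_aug;
  res_exact : forall n, limg (res_d n.+1) = lker (res_d n) }.

(* The complex Hom_A(R, N), whose n-th cohomology is Ext^n_A(M, N). *)
Definition Ext_cocycle M (R : resolution M) N n (f : 'Hom(R n, N)) : Prop :=
  is_hom f /\ (f \o res_d R n)%VF = 0.

Definition Ext_coboundary M (R : resolution M) N n : 'Hom(R n, N) -> Prop :=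
  match n with
  | 0 => fun f => f = 0
  | n'.+1 => fun f =>
      exists2 g : 'Hom(R n', N), is_hom g & f = (g \o res_d R n')%VF
  end.

Definition Ext_zero n M N : Prop :=
  forall (R : resolution M) (f : 'Hom(R n, N)),
    Ext_cocycle f -> Ext_coboundary f.

Definition is_lift M (R : resolution M) (phi : 'Hom(M, M))
    (l : forall n, 'Hom(R n, R n)) : Prop :=
  [/\ forall n, is_hom (l n),
      (res_aug R \o l 0)%VF = (phi \o res_aug R)%VF
    & forall n, (res_d R n \o l n.+1)%VF = (l n \o res_d R n)%VF].

End Modules.

Section Bimodules.

Variables (k : fieldType) (A : falgType k).

Definition reg_act (x a : A) : A := x * a.

Fact reg_act_linl a : linear (reg_act^~ a).
Proof. by move=> c u v; rewrite /reg_act mulrDl scalerAl. Qed.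

Fact reg_act_linr u : linear (reg_act u).
Proof. by move=> c a b; rewrite /reg_act mulrDr scalerAr. Qed.

Fact reg_actr1 u : reg_act u 1 = u.
Proof. exact: mulr1. Qed.

Fact reg_actl1 u : reg_act 1 u = u.
Proof. exact: mul1r. Qed.

Fact reg_actAr u a b : reg_act (reg_act u a) b = reg_act u (a * b).
Proof. by rewrite /reg_act mulrA. Qed.

Fact reg_actAl a b u : reg_act a (reg_act b u) = reg_act (a * b) u.
Proof. exact: mulrA. Qed.

Fact reg_actA a u b : reg_act (reg_act a u) b = reg_act a (reg_act u b).
Proof. by rewrite /reg_act mulrA. Qed.

Definition regular_rmodule : rmodule A :=
  RModule reg_act_linl reg_act_linr reg_actr1 reg_actAr.

Definition regular_bimodule : bimodule A :=
  @Bimodule k A regular_rmodule reg_act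
    reg_act_linl reg_act_linr reg_actl1 reg_actAl reg_actA.

(* DA = Hom_k(A, k) with (f a)(x) = f (a x) and (a f)(x) = f (x a). *)
Definition dual_ract (f : 'Hom(A, k^o)) (a : A) : 'Hom(A, k^o) :=
  (f \o amull a)%VF.

Definition dual_lact (a : A) (f : 'Hom(A, k^o)) : 'Hom(A, k^o) :=
  (f \o amulr a)%VF.

Fact dual_ractE f a x : dual_ract f a x = f (a * x).
Proof. by rewrite comp_lfunE lfunE. Qed.

Fact dual_lactE f a x : dual_lact a f x = f (x * a).
Proof. by rewrite comp_lfunE lfunE. Qed.

Fact dual_ract_linl a : linear (dual_ract^~ a).
Proof.
move=> c f g; apply/lfunP => x.
by rewrite add_lfunE scale_lfunE !dual_ractE add_lfunE scale_lfunE.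
Qed.

Fact dual_ract_linr f : linear (dual_ract f).
Proof.
move=> c a b; apply/lfunP => x; rewrite add_lfunE scale_lfunE !dual_ractE.
by rewrite mulrDl -scalerAl linearP.
Qed.

Fact dual_ract1 f : dual_ract f 1 = f.
Proof. by apply/lfunP => x; rewrite dual_ractE mul1r. Qed.

Fact dual_ractA f a b : dual_ract (dual_ract f a) b = dual_ract f (a * b).
Proof. by apply/lfunP => x; rewrite !dual_ractE mulrA. Qed.

Definition dual_rmodule : rmodule A :=
  RModule dual_ract_linl dual_ract_linr dual_ract1 dual_ractA.

Fact dual_lact_linl f : linear (dual_lact^~ f).
Proof.
move=> c a b; apply/lfunP => x; rewrite add_lfunE scale_lfunE !dual_lactE.
by rewrite mulrDr -scalerAr linearP.
Qed.

Fact dual_lact_linr a : linear (dual_lact a).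
Proof.
move=> c f g; apply/lfunP => x.
by rewrite add_lfunE scale_lfunE !dual_lactE add_lfunE scale_lfunE.
Qed.

Fact dual_lact1 f : dual_lact 1 f = f.
Proof. by apply/lfunP => x; rewrite dual_lactE mulr1. Qed.

Fact dual_lactA a b f : dual_lact a (dual_lact b f) = dual_lact (a * b) f.
Proof. by apply/lfunP => x; rewrite !dual_lactE mulrA. Qed.

Fact dual_lractA a f b :
  dual_ract (dual_lact a f) b = dual_lact a (dual_ract f b).
Proof.
by apply/lfunP => x; rewrite dual_ractE !dual_lactE dual_ractE mulrA.
Qed.

Definition dual_bimodule : bimodule A :=
  @Bimodule k A dual_rmodule dual_lact
    dual_lact_linl dual_lact_linr dual_lact1 dual_lactA dual_lractA.

Definition lmul_lfun (X : bimodule A) (a : A) : 'Hom(X, X) := linfun (lact a).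

Fact lmul_lfunE (X : bimodule A) (a : A) (x : X) : lmul_lfun X a x = lact a x.
Proof.
pose h := GRing.isLinear.Build k X X _ (lact a) (@lact_linr _ _ X a).
pose f : {linear X -> X} := HB.pack (lact a) h.
exact: (lfunE f x).
Qed.

(* [is_Ext_bimodule n X Y E]: E is isomorphic to Ext^n_A(X, Y) as a bimodule.
   The map pi identifies E with cocycles modulo coboundaries for a projective
   resolution R of the right module X (pi is only constrained on cocycles).
   The left action comes from the left action on Y by post-composition; the
   right action comes by functoriality from the left action on X, that is, by
   pre-composition with a lift to R of the endomorphism x |-> a x of X. *)
Definition is_Ext_bimodule n (X Y E : bimodule A) : Prop :=
  exists (R : resolution X) (pi : 'Hom('Hom(R n, Y), E)),
  [/\ forall e : E, exists2 f, Ext_cocycle f & pi f = e,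
      forall f, Ext_cocycle f -> (pi f = 0 <-> Ext_coboundary f),
      forall a f, Ext_cocycle f ->
        pi (lmul_lfun Y a \o f)%VF = lact a (pi f)
    & forall a f (l : forall n, 'Hom(R n, R n)),
        Ext_cocycle f -> is_lift (lmul_lfun X a) l ->
        pi (f \o l n)%VF = ract (pi f) a].

Definition tilting (T : rmodule A) : Prop :=
  [/\ proj_dim_le1 T, Ext_zero 1 T T
    & exists (T' T'' : rmodule A) (f : 'Hom(regular_rmodule, T')) (g : 'Hom(T', T'')),
        [/\ in_add T T', in_add T T'' & short_exact f g]].

End Bimodules.

Section Algebras.

Variable k : fieldType.
Implicit Types A B C H : falgType k.

Definition is_End_algebra H (T : rmodule H) C : Prop :=
  exists phi : 'Hom(C, 'Hom(T, T)),
  [/\ injective phi, phi 1 = \1%VF,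
      forall x y, phi (x * y) = (phi x \o phi y)%VF
    & forall f : 'Hom(T, T), is_hom f <-> exists x, phi x = f].

Definition tilted C : Prop :=
  exists (H : falgType k) (T : rmodule H), [/\ hereditary H, tilting T & is_End_algebra T C].

(* B is isomorphic to the trivial extension of C by E, that is C (+) E with
   (c, e)(c', e') = (c c', c e' + e c'). *)
Definition is_trivial_extension C (E : bimodule C) B : Prop :=
  exists phi : 'Hom(B, (C * E)%type),
  [/\ bijective phi, phi 1 = (1, 0)
    & forall x y, phi (x * y) =
        ((phi x).1 * (phi y).1,
         lact (phi x).1 (phi y).2 + ract (phi x).2 (phi y).1)].

Definition cluster_tilted B : Prop :=
  exists (C : falgType k) (E : bimodule C),
  [/\ tilted C,
      is_Ext_bimodule 2 (dual_bimodule C) (regular_bimodule C) E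
    & is_trivial_extension E B].

Definition idempotent_elt A (e : A) : Prop := e * e = e.

Definition primitive_idempotent A (e : A) : Prop :=
  [/\ idempotent_elt e, e != 0
    & forall f g : A, idempotent_elt f -> idempotent_elt g ->
        f * g = 0 -> g * f = 0 -> e = f + g -> f = 0 \/ g = 0].

Definition complete_primitive A (I : finType) (e : I -> A) : Prop :=
  [/\ forall i, primitive_idempotent (e i),
      forall i j, i != j -> e i * e j = 0
    & \sum_i e i = 1].

Definition connected_algebra A : Prop :=
  forall e : A, idempotent_elt e -> (forall x, e * x = x * e) ->
    e = 0 \/ e = 1.

Definition right_ideal A (U : {vspace A}) : Prop :=
  is_submodule (M := regular_rmodule A) U.

Fact principal_right_ideal A (e : A) : right_ideal (limg (amull e)).
Proof.
move=> _ a /memv_imgP[x _ ->]; apply/memv_imgP; exists (x * a) => //.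
  exact: memvf.
by rewrite !lfunE /= /reg_act mulrA.
Qed.

Definition principal_module A (e : A) : rmodule A :=
  submodule (@principal_right_ideal A e).

Definition basic_algebra A : Prop :=
  forall (I : finType) (e : I -> A), complete_primitive e ->
    forall i j, i != j ->
      ~ is_iso (principal_module (e i)) (principal_module (e j)).

Definition maximal_right_ideal A (U : {vspace A}) : Prop :=
  [/\ right_ideal U, U <> fullv
    & forall V : {vspace A}, right_ideal V -> (U <= V)%VS ->
        V = U \/ V = fullv].

Definition is_radical A (J : {vspace A}) : Prop :=
  forall x, x \in J <->
    (forall U : {vspace A}, maximal_right_ideal U -> x \in U).

(* First Hochschild cohomology with coefficients in A, from the complex
   A -> Hom_k(A, A) -> Hom_k(A (x) A, A). *)
Definition hoch_cocycle1 A (f : 'End(A)) : Prop :=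
  forall a b, a * f b - f (a * b) + f a * b = 0.

Definition hoch_coboundary1 A (f : 'End(A)) : Prop :=
  exists x : A, forall a, f a = a * x - x * a.

Definition HH1_zero A : Prop :=
  forall f : 'End(A), hoch_cocycle1 f -> hoch_coboundary1 f.

End Algebras.

Record quiver := Quiver {
  vertex : finType;
  arrow : finType;
  src : arrow -> vertex;
  tgt : arrow -> vertex }.

(* The number of arrows i -> j is the dimension of e_i (J / J^2) e_j, which is
   e_i J e_j / e_i J^2 e_j. When A = kQ/I with I admissible, this Q is the
   ordinary quiver of A. *)
Definition is_ordinary_quiver (k : fieldType) (A : falgType k) (Q : quiver) :
    Prop :=
  exists (e : vertex Q -> A) (J : {vspace A}),
  [/\ complete_primitive e, is_radical J
    & forall i j : vertex Q,
        #|[set a : arrow Q | (src a == i) && (tgt a == j)]| =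
        (\dim (<[e i]> * J * <[e j]>) -
         \dim (<[e i]> * (J * J) * <[e j]>))%N].

Section Tree.

Variable Q : quiver.

Definition adjacent : rel (vertex Q) := fun i j =>
  [exists a : arrow Q,
     ((src a == i) && (tgt a == j)) || ((src a == j) && (tgt a == i))].

(* An arrow together with a direction in which it is traversed. *)
Definition dart : finType := (arrow Q * bool)%type.

Definition dart_src (d : dart) := if d.2 then src d.1 else tgt d.1.
Definition dart_tgt (d : dart) := if d.2 then tgt d.1 else src d.1.

(* A cycle of the underlying multigraph; it has distinct vertices and distinct
   edges. A loop is a cycle of length 1, and two parallel (or opposite) arrows
   form a cycle of length 2. *)
Definition graph_cycle (c : seq dart) : Prop :=
  [/\ c != [::], cycle (fun d d' => dart_tgt d == dart_src d') c,
      uniq (map dart_src c) & uniq (map fst c)].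

Definition is_tree : Prop :=
  [/\ (0 < #|vertex Q|)%N, forall i j : vertex Q, connect adjacent i j
    & forall c, ~ graph_cycle c].

End Tree.

(* Main.v *)
From HB Require Import structures.
Require Import Defs.
From mathcomp Require Import all_boot all_order all_algebra all_field zify ring.
From Stdlib Require Import Classical_Prop.

(* Write B as the trivial extension of a tilted algebra C by E = Ext^2(DC, C). The
   projection onto E is a derivation of B. If it is inner, it is given by an
   element whose C-component z is central, and central elements act in the same
   way on both sides of E, so that m = mz - zm = 0 for every m in E. Hence B = C
   and Ext^2(DC, C) = 0. As an endomorphism algebra of a rigid module over a
   hereditary algebra, C has global dimension at most 2, and then the vanishing of
   Ext^2(DC, C) forces C to be hereditary.

   If B is hereditary, every weight on the arrows extends to a derivation that
   rescales the arrows. When HH^1(B) = 0 it is inner, so every weight is a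
   difference of vertex potentials; the weight of a single edge of a cycle is not.
   Conversely, if the quiver is a tree, removing an arrow a separates it into two
   sides, the corner of B at a is the line spanned by a, and the commutators with
   the idempotents of the sides realise every derivation that rescales the
   arrows. *)

Set Implicit Arguments.
Unset Strict Implicit.
Unset Printing Implicit Defensive.

Import GRing.Theory.
Local Open Scope ring_scope.

(** * Homomorphisms, powers and products of modules *)

Section Homs.

Variables (k : fieldType) (A : falgType k).
Implicit Types M N P : rmodule A.

(** Two steps need a reason. The vanishing of Ext^2(DC, C) bounds the projective dimension of DC by
    1, so that the kernel of any map from a projective module to DC is projective; every proper
    submodule of a projective module lies in the kernel of a nonzero map of this kind, and induction
    on the dimension reaches all submodules. The path algebra of the quiver is never formed: it may
    be infinite-dimensional as long as cycles are not excluded. Arrows are lifted to elements of the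
    radical J of B instead, and arguments on paths become inductions on products of arrows, which
    stop because J is nilpotent. The freeness that extends a weight to a derivation comes from J
    being a projective right ideal, hence the direct sum of the right ideals generated by the
    arrows. Algebraic closedness enters through the corners at primitive idempotents, which are
    local with residue field k. *)

Lemma linfunE (U V : vectType k) (f : U -> V) : linear f -> linfun f =1 f.
Proof.
move=> lf x; pose h := GRing.isLinear.Build k U V _ f lf.
pose F : {linear U -> V} := HB.pack f h; exact: (lfunE F x).
Qed.

Lemma lfun_of (U V : vectType k) (f : U -> V) :
  linear f -> exists g : 'Hom(U, V), g =1 f.
Proof. by move=> lf; exists (linfun f); apply: linfunE. Qed.

Lemma hom_of M N (f : M -> N) :
  linear f -> (forall m a, f (ract m a) = ract (f m) a) ->
  exists2 g : 'Hom(M, N), is_hom g & g =1 f.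
Proof.
by move=> /lfun_of[g gE] fA; exists g => // m a; rewrite !gE.
Qed.

Lemma ractDl M (a : A) : {morph (@ract k A M)^~ a : u v / u + v}.
Proof.
by move=> u v; have := ract_linl a 1 u v; rewrite !scale1r.
Qed.

Lemma ract0l M (a : A) : ract (0 : M) a = 0.
Proof. by apply: (addrI (ract 0 a)); rewrite -ractDl !addr0. Qed.

Lemma ractZl M (a : A) c (u : M) : ract (c *: u) a = c *: ract u a.
Proof. by have := ract_linl a c u 0; rewrite ract0l !addr0. Qed.

Lemma ractNl M (a : A) (u : M) : ract (- u) a = - ract u a.
Proof. by rewrite -scaleN1r ractZl scaleN1r. Qed.

Lemma ractBl M (a : A) (u v : M) : ract (u - v) a = ract u a - ract v a.
Proof. by rewrite ractDl ractNl. Qed.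

Lemma ractDr M (m : M) : {morph ract m : a b / a + b}.
Proof. by move=> a b; have := ract_linr m 1 a b; rewrite !scale1r. Qed.

Lemma ract0r M (m : M) : ract m 0 = 0.
Proof. by apply: (addrI (ract m 0)); rewrite -ractDr !addr0. Qed.

Lemma ractZr M (m : M) c a : ract m (c *: a) = c *: ract m a.
Proof. by have := ract_linr m c a 0; rewrite ract0r !addr0. Qed.

Lemma ract_suml M I (r : seq I) (Q : pred I) (F : I -> M) a :
  ract (\sum_(i <- r | Q i) F i) a = \sum_(i <- r | Q i) ract (F i) a.
Proof. exact: (big_morph _ (ractDl a) (ract0l M a)). Qed.

Lemma hom0 M N : is_hom (0 : 'Hom(M, N)).
Proof. by move=> m a; rewrite !zero_lfunE ract0l. Qed.

Lemma hom_comp M N P (g : 'Hom(N, P)) (f : 'Hom(M, N)) :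
  is_hom g -> is_hom f -> is_hom (g \o f)%VF.
Proof. by move=> hg hf m a; rewrite !comp_lfunE hf hg. Qed.

Lemma hom_sub M N (g f : 'Hom(M, N)) : is_hom g -> is_hom f -> is_hom (g - f).
Proof.
by move=> hg hf m a; rewrite !add_lfunE !opp_lfunE hf hg ractBl.
Qed.

Lemma lker_submodule M N (f : 'Hom(M, N)) : is_hom f -> is_submodule (lker f).
Proof.
by move=> hf m a; rewrite !memv_ker hf => /eqP ->; rewrite ract0l.
Qed.

Lemma limg_submodule M N (f : 'Hom(M, N)) : is_hom f -> is_submodule (limg f).
Proof.
move=> hf m a /memv_imgP[x _ ->]; rewrite -hf.
exact/memv_img/memvf.
Qed.

Lemma limg_surj M N (f : 'Hom(M, N)) :
  limg f = fullv -> forall y, exists x, f x = y.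
Proof.
move=> sf y; have: y \in limg f by rewrite sf memvf.
by case/memv_imgP => x _ ->; exists x.
Qed.

Lemma surj_limg M N (f : 'Hom(M, N)) :
  (forall y, exists x, f x = y) -> limg f = fullv.
Proof.
move=> sf; apply/vspaceP => y; rewrite memvf; have [x <-] := sf y.
exact/memv_img/memvf.
Qed.

Section Inclusion.
Variables (M : rmodule A) (U : {vspace M}) (hU : is_submodule U).

Lemma incl_hom : exists2 i : 'Hom(submodule hU, M), is_hom i & i =1 vsval.
Proof.
apply: hom_of => [c u v|m a]; first by rewrite linearP.
exact: sub_ractE.
Qed.

Lemma corestrict N (f : 'Hom(N, M)) : is_hom f -> (limg f <= U)%VS ->
  exists2 g : 'Hom(N, submodule hU), is_hom g & forall x, vsval (g x) = f x.
Proof.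
move=> hf fU.
have inU x : f x \in U by apply: (subvP fU); exact/memv_img/memvf.
have [||g hg gE] := @hom_of N (submodule hU) (fun x => vsproj U (f x)).
- by move=> c u v; rewrite !linearP.
- move=> m a; apply: subvs_inj.
  by rewrite [RHS](sub_ractE hU) !vsprojK // hf.
by exists g => // x; rewrite gE vsprojK.
Qed.

End Inclusion.

(** Maps out of a submodule are carried by k-linear maps of the ambient module, so that they can be
    added to and composed with global homomorphisms without a subtype. *)
Definition is_hom_on M N (U : {vspace M}) (h : 'Hom(M, N)) : Prop :=
  {in U, forall m a, h (ract m a) = ract (h m) a}.

Lemma lift_on M N P (U : {vspace P}) (hU : is_submodule U)
    (p : 'Hom(P, M)) (pi : 'Hom(N, M)) :
  projective (submodule hU) -> is_hom p -> is_hom pi -> (p @: U <= limg pi)%VS ->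
  exists2 h : 'Hom(P, N), is_hom_on U h & {in U, forall x, pi (h x) = p x}.
Proof.
move=> pU hp hpi pUpi; have [i hi iE] := incl_hom hU.
have [g hg gE] := corestrict (limg_submodule hpi) hpi (subvv _).
have [|f hf fE] := corestrict (limg_submodule hpi) (hom_comp hp hi).
  apply/subvP => _ /memv_imgP[x _ ->]; apply: (subvP pUpi).
  by rewrite comp_lfunE iE memv_img ?subvsP.
have [|h hh hE] := pU _ _ g f hg _ hf.
  apply: surj_limg => y; have /memv_imgP[x _ yE] := subvsP y.
  by exists x; apply: subvs_inj; rewrite gE.
have [h' h'E] : exists h' : 'Hom(P, N), h' =1 fun x => h (vsproj U x).
  by apply: lfun_of => c u v; rewrite !linearP.
have projE x : x \in U -> pi (h' x) = p x.
  move=> xU; rewrite h'E -gE -comp_lfunE hE fE comp_lfunE iE.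
  by rewrite vsprojK.
exists h' => // x xU a; rewrite !h'E.
rewrite -hh; congr (h _); apply: subvs_inj.
by rewrite [RHS](sub_ractE hU) !vsprojK ?hU.
Qed.

Lemma lift_hom M N P (p : 'Hom(P, M)) (pi : 'Hom(N, M)) :
  projective P -> is_hom p -> is_hom pi -> (limg p <= limg pi)%VS ->
  exists2 h : 'Hom(P, N), is_hom h & forall x, pi (h x) = p x.
Proof.
move=> pP hp hpi ppi.
have [g hg gE] := corestrict (limg_submodule hpi) hpi (subvv _).
have [f hf fE] := corestrict (limg_submodule hpi) hp ppi.
have [|h hh hE] := pP _ _ g f hg _ hf.
  apply: surj_limg => y; have /memv_imgP[x _ yE] := subvsP y.
  by exists x; apply: subvs_inj; rewrite gE.
by exists h => // x; rewrite -gE -comp_lfunE hE.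
Qed.

Lemma projective_retract P N (s : 'Hom(N, P)) (r : 'Hom(P, N)) :
  projective P -> is_hom s -> is_hom r -> (forall x, r (s x) = x) -> projective N.
Proof.
move=> pP hs hr rs M M' g f hg sg hf.
have [h hh hE] := pP _ _ g (f \o r)%VF hg sg (hom_comp hf hr).
exists (h \o s)%VF; first exact: hom_comp.
by rewrite comp_lfunA hE; apply/lfunP => x; rewrite !comp_lfunE rs.
Qed.

Lemma projective_regular : projective (regular_rmodule A).
Proof.
move=> M N g f hg sg hf; have [y yE] := limg_surj sg (f 1).
have [|m a|h hh hE] := @hom_of (regular_rmodule A) M (fun a => ract y a).
- exact: ract_linr.
- by rewrite ractA.
exists h => //; apply/lfunP => a.
rewrite comp_lfunE hE hg yE -hf; congr (f _); exact: mul1r.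
Qed.

(* The carrier of [power_module M n] only unfolds to [{ffun 'I_n -> M}], which
   hides the coercion to functions. *)
Definition coordp M n (u : power_module M n) (i : 'I_n) : M :=
  (u : {ffun 'I_n -> M}) i.

Definition mkp M n (f : 'I_n -> M) : power_module M n :=
  ([ffun i => f i] : {ffun 'I_n -> M}).

Lemma mkpE M n (f : 'I_n -> M) i : coordp (mkp f) i = f i.
Proof. exact: ffunE. Qed.

Lemma powerP M n (u v : power_module M n) :
  (forall i, coordp u i = coordp v i) -> u = v.
Proof. by move=> uv; apply/ffunP => i; apply: uv. Qed.

Lemma coordp_lin M n i : linear (@coordp M n ^~ i).
Proof. by move=> c u v; rewrite /coordp !ffunE. Qed.

Lemma coordp_ract M n (u : power_module M n) a i :
  coordp (ract u a) i = ract (coordp u i) a.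
Proof. exact: ffunE. Qed.

Lemma proj_hom M n i : exists2 p : 'Hom(power_module M n, M),
  is_hom p & p =1 (@coordp M n)^~ i.
Proof. by apply: hom_of (@coordp_lin M n i) _ => u a; apply: coordp_ract. Qed.

Lemma coordpD M n (u v : power_module M n) i :
  coordp (u + v) i = coordp u i + coordp v i.
Proof. exact: ffunE. Qed.

Lemma coordp0 M n i : coordp (0 : power_module M n) i = 0.
Proof. exact: ffunE. Qed.

Lemma coordp_sum M n I (r : seq I) (Q : pred I) (F : I -> power_module M n) i :
  coordp (\sum_(j <- r | Q j) F j) i = \sum_(j <- r | Q j) coordp (F j) i.
Proof. by apply: (big_morph (fun u => coordp u i)) => [u v|]; rewrite ?coordpD ?coordp0. Qed.

Definition injp M n (j : 'I_n) (x : M) : power_module M n :=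
  mkp (fun i => if i == j then x else 0).

Lemma injpE M n (j i : 'I_n) (x : M) : coordp (injp j x) i = if i == j then x else 0.
Proof. exact: mkpE. Qed.

Lemma injp_lin M n j : linear (@injp M n j).
Proof.
move=> c u v; apply: powerP => i; rewrite coordp_lin !injpE.
by case: eqP; rewrite // scaler0 addr0.
Qed.

Lemma injp_ract M n (j : 'I_n) (x : M) a : injp j (ract x a) = ract (injp j x) a.
Proof.
by apply: powerP => i; rewrite coordp_ract !injpE; case: eqP; rewrite ?ract0l.
Qed.

Lemma power_sum M n (u : power_module M n) : u = \sum_j injp j (coordp u j).
Proof.
apply: powerP => i; rewrite coordp_sum (bigD1 i) //= injpE eqxx big1 ?addr0 //.
by move=> j ji; rewrite injpE eq_sym (negPf ji).
Qed.

Lemma inj_hom M n j : exists2 f : 'Hom(M, power_module M n),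
  is_hom f & f =1 @injp M n j.
Proof. by apply: hom_of (@injp_lin M n j) _ => u a; apply: injp_ract. Qed.

Lemma family_hom M N n (f : 'I_n -> 'Hom(N, M)) : (forall i, is_hom (f i)) ->
  exists2 g : 'Hom(N, power_module M n), is_hom g & forall x i, coordp (g x) i = f i x.
Proof.
move=> hf.
have [||g hg gE] := @hom_of N (power_module M n) (fun x => mkp (fun i => f i x)).
- by move=> c u v; apply: powerP => i; rewrite coordp_lin !mkpE linearP.
- by move=> m a; apply: powerP => i; rewrite coordp_ract !mkpE hf.
by exists g => // x i; rewrite gE mkpE.
Qed.

Lemma cofamily_hom M N n (f : 'I_n -> 'Hom(M, N)) : (forall i, is_hom (f i)) ->
  exists2 g : 'Hom(power_module M n, N),
    is_hom g & forall u, g u = \sum_i f i (coordp u i).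
Proof.
move=> hf; apply: hom_of => [c u v|u a].
  rewrite scaler_sumr -big_split; apply: eq_bigr => i _ /=.
  by rewrite coordp_lin linearP.
by rewrite ract_suml; apply: eq_bigr => i _; rewrite coordp_ract hf.
Qed.

Lemma projective_power P n : projective P -> projective (power_module P n).
Proof.
move=> pP M N g f hg sg hf.
have /fin_all_exists2[h hh hE] j : exists2 h : 'Hom(P, M), is_hom h &
    forall x, g (h x) = f (injp j x).
  have [i hi iE] := inj_hom P j.
  have [h hh hE] := pP _ _ g (f \o i)%VF hg sg (hom_comp hf hi).
  by exists h => // x; rewrite -comp_lfunE hE comp_lfunE iE.
have [H hH HE] := cofamily_hom hh; exists H => //; apply/lfunP => u.
rewrite comp_lfunE HE linear_sum [in RHS](power_sum u) linear_sum.
by apply: eq_bigr => i _ /=; rewrite hE.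
Qed.

Definition free_module n := power_module (regular_rmodule A) n.

Lemma projective_free n : projective (free_module n).
Proof. exact/projective_power/projective_regular. Qed.

Lemma free_hom M n (x : 'I_n -> M) : exists2 g : 'Hom(free_module n, M),
  is_hom g & forall u, g u = \sum_i ract (x i) (coordp u i).
Proof.
have /fin_all_exists2[f hf fE] i : exists2 f : 'Hom(regular_rmodule A, M),
    is_hom f & f =1 ract (x i).
  by apply: hom_of; [exact: ract_linr | move=> m a; rewrite ractA].
have [g hg gE] := cofamily_hom hf; exists g => // u; rewrite gE.
by apply: eq_bigr => i _; rewrite fE.
Qed.

Lemma module_fg M :
  exists n (x : 'I_n -> M), forall m, exists u : 'I_n -> A, m = \sum_i ract (x i) (u i).
Proof.
exists (\dim {:M}), (fun i => (vbasis {:M})`_i) => m.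
exists (fun i => (coord (vbasis {:M}) i m)%:A).
rewrite [LHS](coord_vbasis (memvf m)); apply: eq_bigr => i _.
by rewrite ractZr ract1.
Qed.

(** Dual basis lemma: the generators define a free cover, projectivity splits it, and [phi] collects
    the coordinates of the splitting. *)
Lemma projective_dual_basis P n (x : 'I_n -> P) : projective P ->
  (forall p, exists u : 'I_n -> A, p = \sum_i ract (x i) (u i)) ->
  exists2 phi : 'I_n -> 'Hom(P, regular_rmodule A),
    forall i, is_hom (phi i) & forall p, p = \sum_i ract (x i) (phi i p).
Proof.
move=> pP gen; have [g hg gE] := free_hom x.
have h1 : is_hom (\1%VF : 'Hom(P, P)) by move=> m a; rewrite !id_lfunE.
have [|s hs sE] := lift_hom pP h1 hg.
  apply/subvP => y _; have [u yE] := gen y; apply/memv_imgP.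
  exists (@mkp (regular_rmodule A) n u); first exact: memvf.
  by rewrite gE yE; apply: eq_bigr => i _; rewrite mkpE.
have /fin_all_exists2[p hp pE] := fun i : 'I_n => proj_hom (regular_rmodule A) i.
exists (fun i => (p i \o s)%VF) => [i|y]; first exact: hom_comp.
rewrite -[LHS](id_lfunE y) -sE gE.
by apply: eq_bigr => i _; rewrite comp_lfunE pE.
Qed.

(** The converse half of the dual basis lemma: [phi] makes [P] a retract of a free module. *)
Lemma dual_basis_projective P n (x : 'I_n -> P)
    (phi : 'I_n -> 'Hom(P, regular_rmodule A)) :
  (forall i, is_hom (phi i)) -> (forall p, p = \sum_i ract (x i) (phi i p)) ->
  projective P.
Proof.
move=> hphi xphi; have [g hg gE] := free_hom x.
have [s hs sE] := family_hom hphi.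
apply: (projective_retract (@projective_free n) hs hg) => p.
by rewrite gE [RHS]xphi; apply: eq_bigr => i _; rewrite sE.
Qed.

Lemma projective0 P : (forall p q : P, p = q) -> projective P.
Proof.
move=> P0; apply: (@dual_basis_projective P 0 (fun=> 0) (fun=> 0)) => [i|p].
  exact: hom0.
exact: P0.
Qed.

Section Prod.
Variables M N : rmodule A.

Definition prod_ract (u : (M * N)%type) (a : A) : (M * N)%type :=
  (ract u.1 a, ract u.2 a).

Fact prod_ract_linl a : linear (prod_ract^~ a).
Proof. by move=> c u v; rewrite /prod_ract !ractDl !ractZl. Qed.

Fact prod_ract_linr u : linear (prod_ract u).
Proof. by move=> c a b; rewrite /prod_ract !ractDr !ractZr. Qed.

Fact prod_ract1 u : prod_ract u 1 = u.
Proof. by case: u => m n; rewrite /prod_ract !ract1. Qed.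

Fact prod_ractA u a b : prod_ract (prod_ract u a) b = prod_ract u (a * b).
Proof. by rewrite /prod_ract !ractA. Qed.

Definition prod_module : rmodule A :=
  RModule prod_ract_linl prod_ract_linr prod_ract1 prod_ractA.

Lemma prod_hom P (f : 'Hom(M, P)) (g : 'Hom(N, P)) : is_hom f -> is_hom g ->
  exists2 h : 'Hom(prod_module, P), is_hom h & forall u, h u = f u.1 + g u.2.
Proof.
move=> hf hg; apply: hom_of => [c u v|m a] /=.
  by rewrite !linearP addrACA -scalerDr.
by rewrite hf hg -ractDl.
Qed.

Lemma hom_prod P (f : 'Hom(P, M)) (g : 'Hom(P, N)) : is_hom f -> is_hom g ->
  exists2 h : 'Hom(P, prod_module), is_hom h & forall x, h x = (f x, g x).
Proof.
move=> hf hg; apply: hom_of => [c u v|m a] /=; first by rewrite !linearP.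
by rewrite hf hg.
Qed.

Lemma projective_prod : projective M -> projective N -> projective prod_module.
Proof.
move=> pM pN X Y g f hg sg hf.
have [i hi iE] : exists2 i : 'Hom(M, prod_module), is_hom i & forall m, i m = (m, 0).
  apply: hom_of => [c u v|m a]; apply: injective_projections => //=.
    by rewrite scaler0 addr0.
  by rewrite ract0l.
have [j hj jE] : exists2 i : 'Hom(N, prod_module), is_hom i & forall m, i m = (0, m).
  apply: hom_of => [c u v|m a]; apply: injective_projections => //=.
    by rewrite scaler0 addr0.
  by rewrite ract0l.
have [h hh hE] := pM _ _ g (f \o i)%VF hg sg (hom_comp hf hi).
have [h' hh' hE'] := pN _ _ g (f \o j)%VF hg sg (hom_comp hf hj).
have [H hH HE] := prod_hom hh hh'; exists H => //; apply/lfunP => u.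
rewrite comp_lfunE HE linearD /= -!comp_lfunE hE hE' !comp_lfunE iE jE -linearD /=.
by congr (f _); case: u => m n /=; congr (_, _); rewrite ?addr0 ?add0r.
Qed.

End Prod.

End Homs.

(** * Extensions over a hereditary algebra *)

Section Ext.

Variables (k : fieldType) (A : falgType k).
Implicit Types F M N P : rmodule A.

(** The kernel of [p] is projective since [A] is hereditary, so with [F] it forms a projective
    resolution of [M] of length one. The restriction of [q] to it is a 1-cocycle, and being a
    coboundary means extending to [F]. *)
Lemma Ext1_extend F M N (p : 'Hom(F, M)) (q : 'Hom(F, N)) :
  hereditary A -> Ext_zero 1 M N -> projective F -> is_hom p -> limg p = fullv ->
  is_hom_on (lker p) q ->
  exists2 r : 'Hom(F, N), is_hom r & {in lker p, r =1 q}.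
Proof.
move=> herA ext pF hp sp hq; pose K := submodule (lker_submodule hp).
have [i hi iE] := incl_hom (lker_submodule hp).
(* The zero module fills the degrees from 2 on. *)
pose Z := free_module A 0; have Z0 (u v : Z) : u = v by apply: powerP => -[].
pose R n : rmodule A := match n with 0 => F | 1 => K | _ => Z end.
pose d n : 'Hom(R n.+1, R n) := 
  match n as n0 return 'Hom(R n0.+1, R n0) with
  0 => i | n'.+1 => (0%R : 'Hom(R n'.+2, R n'.+1)) end.
have injK : lker i = 0%VS.
  by apply/eqP/lker0P => u v; rewrite !iE; apply: subvs_inj.
have pR n : projective (R n).
  by case: n => [//|[|n]]; [exact: herA | exact: projective_free].
have hd n : is_hom (d n) by case: n => [|n]; [exact: hi | exact: hom0].
have ex0 : limg (d 0) = lker p.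
  apply/vspaceP => x; apply/memv_imgP/idP => [[y _ ->]|xK].
    by rewrite iE subvsP.
  by exists (vsproj _ x); rewrite ?memvf // iE vsprojK.
have ex n : limg (d n.+1) = lker (d n).
  case: n => [|n]; rewrite lim0g ?injK //; apply/esym/eqP.
  by rewrite -subv0; apply/subvP => x _; rewrite (Z0 x 0) mem0v.
have [|g hg gE] := ext (@Resolution k A M R d p pR hd hp sp ex0 ex) (q \o i)%VF.
- split=> [u a|]; last by rewrite comp_lfun0r.
  by rewrite !comp_lfunE !iE sub_ractE ?hq ?subvsP //; apply: lker_submodule.
exists g => // x xK; move: (congr1 (fun f : 'Hom(K, N) => f (vsproj _ x)) gE).
by rewrite !comp_lfunE iE vsprojK.
Qed.

(** A map from F^m to M^n is a matrix of maps from [F] to [M], and each entry is extended from the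
    kernel of [p] separately. *)
Lemma Ext1_extend_power M n m F (p : 'Hom(F, M))
    (q : 'Hom(power_module F m, power_module M n)) :
  hereditary A -> Ext_zero 1 M M -> projective F -> is_hom p -> limg p = fullv ->
  (forall u a, (forall i, p (coordp u i) = 0) -> q (ract u a) = ract (q u) a) ->
  exists2 r : 'Hom(power_module F m, power_module M n), is_hom r &
    forall u, (forall i, p (coordp u i) = 0) -> r u = q u.
Proof.
move=> herA ext pF hp sp hq.
have inj0 j x : p x = 0 -> forall i : 'I_m, p (coordp (injp j x) i) = 0.
  by move=> px0 i; rewrite injpE; case: eqP; rewrite ?linear0.
have /fin_all_exists2[r_ hr rE] (ij : 'I_n * 'I_m) : exists2 r : 'Hom(F, M),
    is_hom r & {in lker p, r =1 fun x => coordp (q (injp ij.2 x)) ij.1}.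
  case: ij => i j /=.
  have [c hc cE] := inj_hom F j; have [b hb bE] := proj_hom M i.
  have [|r hr rE] := @Ext1_extend _ _ _ p (b \o q \o c)%VF herA ext pF hp sp.
    move=> x; rewrite memv_ker => /eqP px0 a.
    by rewrite !comp_lfunE !cE injp_ract hq ?hb //; apply: inj0.
  by exists r => // x xK; rewrite rE // !comp_lfunE cE bE.
have /fin_all_exists2[s hs sE] i := cofamily_hom (fun j => hr (i, j)).
have [r hr' r'E] := family_hom hs; exists r => // u pu0.
apply: powerP => i; rewrite r'E sE [in RHS](power_sum u) linear_sum coordp_sum.
by apply: eq_bigr => j _; rewrite rE // memv_ker pu0.
Qed.

Lemma factor_surj M N P (p : 'Hom(M, P)) (f : 'Hom(M, N)) :
  is_hom p -> limg p = fullv -> is_hom f -> (forall x, p x = 0 -> f x = 0) ->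
  exists2 g : 'Hom(P, N), is_hom g & forall x, g (p x) = f x.
Proof.
move=> hp sp hf pf; have pK y : p ((p^-1)%VF y) = y.
  by rewrite limg_lfunVK ?sp ?memvf.
have fE x : f ((p^-1)%VF (p x)) = f x.
  by apply/eqP; rewrite -subr_eq0 -linearB; apply/eqP/pf; rewrite linearB /= pK subrr.
(* [p^-1] is only a k-linear section; the composite is a homomorphism because [f] kills the kernel
   of [p]. *)
exists (f \o p^-1)%VF => [y a|x]; last by rewrite comp_lfunE fE.
by rewrite !comp_lfunE -{1}[y]pK -hp fE hf.
Qed.

(* The preimage of [limg pi] in a free cover of M^m is projective since A is
   hereditary, so that its map to [limg pi] lifts along [pi]; as Ext^1(M^m, ker pi)
   vanishes, the lift can be corrected to factor through [limg pi]. *)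
Lemma split_over_image M n m
    (pi : 'Hom(power_module M n, power_module M m)) :
  hereditary A -> Ext_zero 1 M M -> is_hom pi ->
  (forall c : 'Hom(M, power_module M m), is_hom c -> (limg c <= limg pi)%VS ->
     exists2 c' : 'Hom(M, power_module M n), is_hom c' & forall x, pi (c' x) = c x) ->
  exists2 s : 'Hom(power_module M m, power_module M n),
    is_hom_on (limg pi) s & {in limg pi, forall x, pi (s x) = x}.
Proof.
move=> herA ext hpi lift; have [d [x gen]] := module_fg M.
have pF := @projective_free _ A d.
have [p hp pE] := free_hom x.
have sp : limg p = fullv.
  apply: surj_limg => y; have [u ->] := gen y; exists (@mkp _ _ (regular_rmodule A) d u).
  by rewrite pE; apply: eq_bigr => i _; rewrite mkpE.
pose G := power_module (free_module A d) m.
have [P hP PE] : exists2 P : 'Hom(G, power_module M m), is_hom P &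
    forall u i, coordp (P u) i = p (coordp u i).
  have /fin_all_exists2[b hb bE] := fun i : 'I_m => proj_hom (free_module A d) i.
  have [i|P hP PE] := @family_hom _ _ _ G _ (fun i => p \o b i)%VF.
    exact: hom_comp.
  by exists P => // u i; rewrite PE comp_lfunE bE.
have P0 u : (forall i, p (coordp u i) = 0) <-> P u = 0.
  split=> [u0|u0 i]; last by rewrite -PE u0 coordp0.
  by apply: powerP => i; rewrite PE u0 coordp0.
have hW : is_submodule (P @^-1: limg pi)%VS.
  by move=> u a; rewrite -!memv_preim hP; apply: limg_submodule.
have [|g hg gE] := lift_on (herA _ _ hW (projective_power (n := m) pF)) hP hpi.
  by apply/subvP => _ /memv_imgP[u uW ->]; rewrite memv_preim.
have kerW u : P u = 0 -> u \in (P @^-1: limg pi)%VS.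
  by rewrite -memv_preim => ->; apply: mem0v.
have [|r hr rE] := @Ext1_extend_power M n m _ p g herA ext pF hp sp.
  by move=> u a /P0 Pu; apply/hg/kerW.
have sP : limg P = fullv.
  apply: surj_limg => y.
  have [u uE] := fin_all_exists (fun i : 'I_m => limg_surj sp (coordp y i)).
  by exists (@mkp _ _ (free_module A d) m u); apply: powerP => i; rewrite PE mkpE.
(* [pi r] kills [ker P], hence factors through [P]; the factor lifts along [pi],
   which corrects [r] into an extension of [g] with values in [ker pi]. *)
have [u Pu0|w hw wE] := factor_surj hP sP (hom_comp hpi hr).
  rewrite comp_lfunE rE; last exact/P0.
  by rewrite gE ?Pu0 //; apply: kerW.
have /fin_all_exists2[v_ hv_ v_E] j : exists2 c : 'Hom(M, power_module M n),
    is_hom c & forall x, pi (c x) = w (injp j x).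
  have [b hb bE] := inj_hom M j.
  have [||c hc cE] := lift (w \o b)%VF; first exact: hom_comp.
    apply/subvP => _ /memv_imgP[y _ ->]; have [u uE] := limg_surj sP (b y).
    by rewrite comp_lfunE -uE wE comp_lfunE; apply/memv_img/memvf.
  by exists c => // y; rewrite cE comp_lfunE bE.
have [v hv vE] := cofamily_hom hv_.
have {}vE y : pi (v y) = w y.
  rewrite vE linear_sum [in RHS](power_sum y) linear_sum.
  by apply: eq_bigr => j _ /=; rewrite v_E.
pose h := g - r + (v \o P)%VF.
have hE u : u \in (P @^-1: limg pi)%VS -> pi (h u) = P u.
  move=> uW; rewrite !add_lfunE opp_lfunE comp_lfunE linearD linearB /=.
  by rewrite vE wE comp_lfunE subrK gE.
have h0 u : P u = 0 -> h u = 0.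
  move=> Pu; rewrite !add_lfunE opp_lfunE comp_lfunE Pu linear0 addr0 rE ?subrr //.
  exact/P0.
have hh : is_hom_on (P @^-1: limg pi) h.
  move=> u uW a; rewrite !add_lfunE !opp_lfunE !comp_lfunE hP hg // hr hv.
  by rewrite ractDl ractBl.
have PK y : P ((P^-1)%VF y) = y by rewrite limg_lfunVK ?sP ?memvf.
have VW y : y \in limg pi -> (P^-1)%VF y \in (P @^-1: limg pi)%VS.
  by rewrite -memv_preim PK.
exists (h \o P^-1)%VF => y /VW yW => [a|]; rewrite !comp_lfunE ?hE //.
rewrite -hh //; apply/eqP; rewrite -subr_eq0 -linearB /=; apply/eqP/h0.
by rewrite linearB /= hP !PK subrr.
Qed.

End Ext.

(** * Endomorphism algebras of rigid modules *)

Section GlobalDimension.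

Variable k : fieldType.

(* Over a finite-dimensional algebra this says that the global dimension is at
   most 2. *)
Definition kernels_projective (A : falgType k) : Prop :=
  forall (M N K : rmodule A) (f : 'Hom(M, N)) (i : 'Hom(K, M)),
    projective M -> projective N -> is_hom f -> is_hom i ->
    lker i = 0%VS -> limg i = lker f -> projective K.

(* The kernel of C^m -> C^n consists of the tuples [c] with [c T] in the kernel of
   the corresponding map T^m -> T^n; a k-basis of it defines T^d -> T^m, and a
   section of this map over its image provides a dual basis. *)
Lemma End_kernels_projective (H : falgType k) (T : rmodule H) (C : falgType k) :
  hereditary H -> Ext_zero 1 T T -> is_End_algebra T C -> kernels_projective C.
Proof.
move=> herH ext [phi [phi_inj phi1 phiM phiH]] M N K f i pM pN hf hi i_inj imi.
have {i_inj} i_inj : injective i by apply/lker0P; rewrite i_inj.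
have phi_hom c : is_hom (phi c) by apply/phiH; exists c.
have [m [x genx]] := module_fg M; have [al hal alE] := projective_dual_basis pM genx.
have [n [y geny]] := module_fg N; have [psi hpsi psiE] := projective_dual_basis pN geny.
have [X hX XE] := free_hom x.
(* The matrix of [f] in the two dual bases; a tuple in C^m lies over the kernel of [f] exactly when
   this matrix kills it. *)
pose a j r := psi j (f (x r)).
have fX c : f (X c) = 0 <-> forall j, \sum_r (a j r : C) * coordp c r = 0.
  have aE j : psi j (f (X c)) = \sum_r (a j r : C) * coordp c r.
    by rewrite XE !linear_sum; apply: eq_bigr => r _ /=; rewrite hf hpsi.
  split=> [fXc j|a0]; first by rewrite -aE fXc linear0.
  by rewrite (psiE (f (X c))) big1 // => j _; rewrite aE a0 ract0r.
pose N0 := lker (f \o X)%VF; pose d := \dim N0.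
pose c_ (l : 'I_d) : free_module C m := (vbasis N0)`_l.
have c_N0 l : f (X (c_ l)) = 0.
  by apply/eqP; rewrite -comp_lfunE -memv_ker vbasis_mem // mem_nth // size_tuple.
have c_span c : f (X c) = 0 -> exists lam : 'I_d -> k, c = \sum_l lam l *: c_ l.
  move=> c0; exists (fun l => coord (vbasis N0) l c); apply: coord_vbasis.
  by rewrite memv_ker comp_lfunE c0.
have [pi hpi piE] : exists2 pi : 'Hom(power_module T d, power_module T m), is_hom pi &
    forall t r, coordp (pi t) r = \sum_l phi (coordp (c_ l) r) (coordp t l).
  have /fin_all_exists2[b hb bE] r := cofamily_hom (fun l : 'I_d => phi_hom (coordp (c_ l) r)).
  have [pi hpi piE] := family_hom hb; exists pi => // t r.
  by rewrite piE bE.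
have in_pi (c : 'I_m -> C) t : f (X (@mkp _ _ (regular_rmodule C) m c)) = 0 ->
    exists lam : 'I_d -> k,
    mkp (fun r => phi (c r) t) = pi (mkp (fun l => lam l *: t)).
  move=> /c_span[lam cE]; exists lam; apply: powerP => r; rewrite piE mkpE.
  have -> : c r = \sum_l lam l *: coordp (c_ l) r.
    rewrite -[LHS](@mkpE _ _ (regular_rmodule C) m) cE coordp_sum.
    by apply: eq_bigr => l _; have := coordp_lin r (lam l) (c_ l) 0; rewrite coordp0 !addr0.
  rewrite linear_sum sum_lfunE; apply: eq_bigr => l _ /=.
  by rewrite mkpE !linearZ /= scale_lfunE.
(* A map from [T] to T^m is a tuple of elements of [C]. If its image lies in that of [pi], the
   matrix [a] kills the tuple, which is then a k-combination of the [c_ l]. *)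
have [|s hs sE] := split_over_image herH ext hpi.
  move=> g hg gpi.
  have /fin_all_exists[ga gaE] r : exists c, forall t, phi c t = coordp (g t) r.
    have [b hb bE] := proj_hom T r.
    have [c cE] := (phiH (b \o g)%VF).1 (hom_comp hb hg).
    by exists c => t; rewrite cE comp_lfunE bE.
  have ga0 : f (X (@mkp _ _ (regular_rmodule C) m ga)) = 0.
    apply/fX => j; apply: phi_inj; rewrite linear0; apply/lfunP => t.
    rewrite zero_lfunE linear_sum sum_lfunE.
    have /memv_imgP[u _ gt] : g t \in limg pi.
      by apply: (subvP gpi); apply/memv_img/memvf.
    transitivity (\sum_l phi (\sum_r (a j r : C) * coordp (c_ l) r) (coordp u l)).
      rewrite (eq_bigr (fun r => \sum_l phi ((a j r : C) * coordp (c_ l) r) (coordp u l))).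
        by rewrite exchange_big; apply: eq_bigr => l _; rewrite linear_sum sum_lfunE.
      move=> r _ /=; rewrite mkpE phiM comp_lfunE gaE gt piE linear_sum.
      by apply: eq_bigr => l _; rewrite phiM comp_lfunE.
    by rewrite big1 // => l _; rewrite (fX (c_ l)).1 ?linear0 ?zero_lfunE.
  have /c_span[lam gaE'] := ga0.
  (* The coefficients are scalars, so the lift to T^d is scalar multiplication in each
     coordinate. *)
  have [l|g' hg' g'E] := @family_hom _ _ T T d (fun l => lam l *: \1%VF).
    by move=> t b; rewrite !scale_lfunE !id_lfunE ractZl.
  exists g' => // t; apply: powerP => r; rewrite piE -gaE.
  have -> : ga r = \sum_l lam l *: coordp (c_ l) r.
    rewrite -[LHS](@mkpE _ _ (regular_rmodule C) m) gaE' coordp_sum.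
    by apply: eq_bigr => l _; have := coordp_lin r (lam l) (c_ l) 0; rewrite coordp0 !addr0.
  rewrite linear_sum sum_lfunE; apply: eq_bigr => l _ /=.
  by rewrite g'E scale_lfunE id_lfunE !linearZ /= scale_lfunE.
(* An element of [K], read as a tuple in C^m through the dual basis of [M], evaluated at [t]. *)
pose w ka t : power_module T m := mkp (fun r => phi (al r (i ka)) t).
have w_pi ka t : w ka t \in limg pi.
  have [|lam wE] := in_pi (fun r => al r (i ka)) t; last first.
    by rewrite /w wE; apply/memv_img/memvf.
  rewrite XE; under eq_bigr do rewrite mkpE.
  by rewrite -alE; apply/eqP; rewrite -memv_ker -imi; apply/memv_img/memvf.
have w_lin ka : linear (w ka).
  by move=> b u v; apply: powerP => r; rewrite coordp_lin !mkpE linearP.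
have w_ract ka t b : w ka (ract t b) = ract (w ka t) b.
  by apply: powerP => r; rewrite coordp_ract !mkpE phi_hom.
(* The coordinates of the future dual basis: [s] lifts the map [w ka] to T^d, and each component of
   the lift is an endomorphism of [T], hence an element of [C]. *)
have [de deE] : exists de : 'I_d -> K -> C,
    forall l ka t, phi (de l ka) t = coordp (s (w ka t)) l.
  have /fin_all_exists2[b hb bE] := fun l : 'I_d => proj_hom T l.
  have /fin_all_exists2[J hJ JE] := fun r : 'I_m => inj_hom T r.
  have [W WE] : exists W : K -> 'Hom(T, power_module T d), forall ka t, W ka t = s (w ka t).
    exists (fun ka => s \o \sum_r (J r \o phi (al r (i ka))))%VF => ka t.
    rewrite comp_lfunE sum_lfunE; congr (s _); rewrite [RHS]power_sum.
    by apply: eq_bigr => r _; rewrite comp_lfunE JE mkpE.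
  exists (fun l ka => (phi^-1)%VF (b l \o W ka)%VF) => l ka t.
  have [|c cE] := (phiH (b l \o W ka)%VF).1.
    by move=> u v; rewrite !comp_lfunE !WE w_ract hs ?w_pi // hb.
  by rewrite -cE lker0_lfunK ?cE ?comp_lfunE ?WE ?bE //; apply/lker0P.
have deP ka r : al r (i ka) = \sum_l (coordp (c_ l) r : C) * de l ka.
  apply: phi_inj; apply/lfunP => t; rewrite linear_sum sum_lfunE.
  rewrite -[LHS](mkpE (fun r => phi (al r (i ka)) t)) -[mkp _](sE _ (w_pi ka t)) piE.
  by apply: eq_bigr => l _ /=; rewrite phiM comp_lfunE deE.
have /fin_all_exists2[D hD DE] l : exists2 D : 'Hom(K, regular_rmodule C),
    is_hom D & D =1 de l.
  apply: hom_of => [b u v|u b]; apply: phi_inj; apply/lfunP => t.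
    rewrite linearP add_lfunE scale_lfunE !deE /=.
    have -> : w (b *: u + v) t = b *: w u t + w v t.
      apply: powerP => r; rewrite coordp_lin !mkpE !linearP /=.
      by rewrite add_lfunE scale_lfunE.
    by rewrite linearP coordp_lin.
  rewrite phiM comp_lfunE !deE; congr (coordp (s _) l).
  by apply: powerP => r; rewrite !mkpE hi hal phiM comp_lfunE.
have /fin_all_exists[z zE] l : exists z, i z = X (c_ l).
  have /memv_imgP[z _ ->] : X (c_ l) \in limg i by rewrite imi memv_ker c_N0.
  by exists z.
apply: (dual_basis_projective (x := z) hD) => ka; apply: i_inj.
rewrite [LHS]alE linear_sum.
under [RHS]eq_bigr do rewrite /= hi zE XE ract_suml.
rewrite exchange_big; apply: eq_bigr => r _ /=.
rewrite deP (big_morph _ (ractDr (x r)) (ract0r (x r))).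
by apply: eq_bigr => l _; rewrite ractA DE.
Qed.

End GlobalDimension.

(** * Vanishing of the second extension group *)

Section Hereditary.

Variables (k : fieldType) (C : falgType k).
Implicit Types M N P K U : rmodule C.

Lemma functional_vanishing (V : vectType k) (U : {vspace V}) : U <> fullv ->
  exists2 f : 'Hom(V, k^o), (U <= lker f)%VS & exists x, f x != 0.
Proof.
move=> Unf; have [x _ xU] : exists2 x, x \in fullv & x \notin U.
  by apply/subvPn; apply/negP => fU; apply/Unf/eqP; rewrite eqEsubv subvf.
pose W := (U^C)%VS; pose q := daddv_pi W U.
have dWU : (W :&: U = 0)%VS by rewrite capvC capv_compl.
have dUW : (U :&: W = 0)%VS by rewrite capv_compl.
have qD v : daddv_pi U W v + q v = v.
  by rewrite daddv_pi_add ?addv_complf ?memvf.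
have qU u : u \in U -> q u = 0.
  move=> uU; have := qD u; rewrite daddv_pi_id // => /(canRL (addKr _)).
  by rewrite addNr.
have qx : q x != 0.
  by apply: contraNneq xU => qx0; rewrite -(qD x) qx0 addr0 memv_pi.
have [j xj] : exists j, coord (vbasis W) j (q x) != 0.
  apply/existsP; apply: contraNT qx; rewrite negb_exists => /forallP x0.
  rewrite (coord_vbasis (memv_pi _ _ _)) big1 // => j _.
  by move: (x0 j); rewrite negbK => /eqP ->; rewrite scale0r.
have [f fE] : exists f : 'Hom(V, k^o), f =1 fun v => coord (vbasis W) j (q v).
  by apply: lfun_of => c u v; rewrite !linearP.
exists f; last by exists x; rewrite fE.
by apply/subvP => u uU; rewrite memv_ker fE qU // linear0.
Qed.

(** The bijection between Hom_k(P, k) and Hom_C(P, DC): [g p] sends [c] to [f (ract p c)]. Its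
    kernel is the largest submodule on which [f] vanishes. *)
Lemma dual_hom P (f : 'Hom(P, k^o)) : exists2 g : 'Hom(P, dual_rmodule C),
  is_hom g & forall p, (g p = 0) <-> (forall c, f (ract p c) = 0).
Proof.
have actE (p : P) : linfun (ract p) =1 ract p by apply/linfunE/ract_linr.
have [|p a|g hg gE] :=
    @hom_of _ C P (dual_rmodule C) (fun p => (f \o linfun (ract p))%VF).
- move=> c u v; apply/lfunP => a; rewrite add_lfunE scale_lfunE.
  by rewrite !comp_lfunE !actE ract_linl linearP.
- by apply/lfunP => c; rewrite [RHS]dual_ractE !comp_lfunE !actE ractA.
exists g => // p; rewrite gE; split=> [g0 c|f0].
  have := congr1 (fun h : 'Hom(C, k^o) => h c) g0.
  by rewrite zero_lfunE comp_lfunE actE.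
by apply/lfunP => c; rewrite zero_lfunE comp_lfunE actE f0.
Qed.

(* The vanishing of Ext^2 makes the second syzygy a direct summand of [R 1]. *)
Lemma syzygy_projective M (R : resolution M) : kernels_projective C ->
  (forall f : 'Hom(R 2, regular_rmodule C), Ext_cocycle f -> Ext_coboundary f) ->
  projective (submodule (lker_submodule (@res_aug_hom _ _ _ R))).
Proof.
move=> gl ext; pose K2 := submodule (lker_submodule (@res_d_hom _ _ _ R 0)).
have [i hi iE] := incl_hom (lker_submodule (@res_d_hom _ _ _ R 0)).
have i_inj : lker i = 0%VS.
  by apply/eqP/lker0P => u v; rewrite !iE; apply: subvs_inj.
have pK2 : projective K2.
  apply: (gl _ _ _ _ _ (@res_proj _ _ _ R 1) (@res_proj _ _ _ R 0) (@res_d_hom _ _ _ R 0) hi i_inj).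
  apply/vspaceP => x; apply/memv_imgP/idP => [[y _ ->]|xK].
    by rewrite iE subvsP.
  by exists (vsproj _ x); rewrite ?memvf // iE vsprojK.
have [d1 hd1 d1E] : exists2 d1 : 'Hom(R 2, K2), is_hom d1 &
    forall u, vsval (d1 u) = res_d R 1 u.
  by apply: corestrict (@res_d_hom _ _ _ R 1) _; rewrite res_exact.
have [d [x genx]] := module_fg K2; have [phi hphi phiE] := projective_dual_basis pK2 genx.
(* Each coordinate of the second syzygy, pulled back to [R 2], is a 2-cocycle; as a coboundary it
   extends to [R 1]. *)
have /fin_all_exists2[g hg gE] (l : 'I_d) :
    exists2 g : 'Hom(R 1, regular_rmodule C), is_hom g &
    forall u, g (res_d R 1 u) = phi l (d1 u).
  have [|g hg gE] := ext (phi l \o d1)%VF.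
    split; first exact: hom_comp.
    apply/lfunP => u; rewrite !comp_lfunE zero_lfunE.
    suff -> : d1 (res_d R 2 u) = 0 by rewrite linear0.
    apply: subvs_inj; rewrite d1E linear0; apply/eqP.
    by rewrite -memv_ker -res_exact memv_img ?memvf.
  exists g => // u; have := congr1 (fun h : 'Hom(_, _) => h u) gE.
  by rewrite !comp_lfunE.
have [X hX XE] := free_hom x; have [G hG GE] := family_hom hg.
have rho_id u : X (G (i (d1 u))) = d1 u.
  rewrite XE [RHS]phiE; apply: eq_bigr => l _.
  by rewrite GE iE d1E gE.
have [r hr rE] : exists2 r : 'Hom(R 1, submodule (lker_submodule (@res_aug_hom _ _ _ R))),
    is_hom r & forall u, vsval (r u) = res_d R 0 u.
  by apply: corestrict (@res_d_hom _ _ _ R 0) _; rewrite res_exact0.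
have sr : limg r = fullv.
  apply: surj_limg => y; have : vsval y \in limg (res_d R 0) by rewrite res_exact0 subvsP.
  case/memv_imgP => u _ yE.
  by exists u; apply: subvs_inj; rewrite rE.
have h1 : is_hom (\1%VF : 'Hom(R 1, R 1)) by move=> m a; rewrite !id_lfunE.
(* The identity minus the retraction onto the second syzygy kills that syzygy, hence factors through
   the first one and splits [r]. *)
have [u ru0|s hs sE] := factor_surj hr sr
    (hom_sub h1 (hom_comp hi (hom_comp hX hG))).
  rewrite add_lfunE opp_lfunE id_lfunE !comp_lfunE; apply/eqP; rewrite subr_eq0; apply/eqP.
  have : u \in limg (res_d R 1) by rewrite res_exact memv_ker -rE ru0 linear0.
  case/memv_imgP => v _ uE.
  have -> : u = i (d1 v) by rewrite iE d1E.
  by rewrite rho_id.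
apply: (projective_retract (@res_proj _ _ _ R 1) hs hr) => y.
have [u <-] := limg_surj sr y; rewrite sE add_lfunE opp_lfunE id_lfunE linearB /= comp_lfunE.
rewrite [X in _ - X](_ : _ = 0) ?subr0 //; apply: subvs_inj.
by rewrite rE linear0 iE; apply/eqP; rewrite -memv_ker subvsP.
Qed.

(* With [h : P -> R 0] lifting [g], the kernel of [g] is the pullback of [h] and
   of the inclusion of the first syzygy, that is, the kernel of a map between the
   projective modules [P * Omega(DC)] and [R 0]. *)
Lemma kernel_to_dual_projective P K (g : 'Hom(P, dual_rmodule C)) (i : 'Hom(K, P))
    (R : resolution (dual_rmodule C)) :
  kernels_projective C ->
  (forall f : 'Hom(R 2, regular_rmodule C), Ext_cocycle f -> Ext_coboundary f) ->
  projective P -> is_hom g -> is_hom i -> lker i = 0%VS -> limg i = lker g ->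
  projective K.
Proof.
move=> gl ext pP hg hi i_inj imi; have pK1 := syzygy_projective gl ext.
have [h hh hE] : exists2 h : 'Hom(P, R 0), is_hom h & forall x, res_aug R (h x) = g x.
  by apply: lift_hom (@res_aug_hom _ _ _ R) _; rewrite // res_aug_surj subvf.
have [i1 hi1 i1E] := incl_hom (lker_submodule (@res_aug_hom _ _ _ R)).
have [c hc cE] : exists2 c : 'Hom(K, submodule (lker_submodule (@res_aug_hom _ _ _ R))),
    is_hom c & forall x, vsval (c x) = h (i x).
  have [||c hc cE] := @corestrict _ _ _ _ (lker_submodule (@res_aug_hom _ _ _ R)) K (h \o i)%VF.
  - exact: hom_comp.
  - apply/subvP => _ /memv_imgP[x _ ->]; rewrite memv_ker comp_lfunE hE -memv_ker -imi.
    exact/memv_img/memvf.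
  by exists c => // x; rewrite cE comp_lfunE.
have [F hF FE] := prod_hom hh (hom_sub (@hom0 _ _ _ _) hi1).
have [j hj jE] := hom_prod hi hc.
apply: (gl _ _ _ F j (projective_prod pP pK1) (@res_proj _ _ _ R 0) hF hj).
  move/eqP/lker0P: i_inj => i_inj; apply/eqP/lker0P => u v.
  by rewrite !jE => -[/i_inj].
apply/vspaceP => u; rewrite memv_ker FE sub0r opp_lfunE i1E subr_eq0.
apply/memv_imgP/eqP => [[x _ ->]|]; first by rewrite jE /= cE.
case: u => p q /= hpq; have : p \in limg i.
  by rewrite imi memv_ker -hE hpq -memv_ker subvsP.
case/memv_imgP => x _ pE; exists x; rewrite ?memvf // jE -pE; congr (_, _).
by apply: subvs_inj; rewrite cE -pE.
Qed.

(* A proper submodule of P is killed by a nonzero functional on P, hence lies in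
   the kernel of a nonzero map P -> DC, to which the induction applies. *)
Lemma kernels_hereditary (R : resolution (dual_rmodule C)) :
  kernels_projective C ->
  (forall f : 'Hom(R 2, regular_rmodule C), Ext_cocycle f -> Ext_coboundary f) ->
  hereditary C.
Proof.
move=> gl ext.
(* Stated for injections rather than submodules, so that the induction can replace [P] by the kernel
   of a map out of it. *)
have main n P U (i : 'Hom(U, P)) : (\dim {:P} <= n)%N -> projective P ->
    is_hom i -> lker i = 0%VS -> projective U.
  elim: n P U i => [|n IHn] P U i dP pP hi i_inj.
    apply: projective0 => u v; move/eqP/lker0P: i_inj; apply.
    move: dP; rewrite leqn0 dimv_eq0 => /eqP P0.
    by have := memvf (i u); have := memvf (i v); rewrite P0 !memv0 => /eqP -> /eqP ->.
  have [imi|/eqP/functional_vanishing[f fi [x fx]]] := eqVneq (limg i) fullv.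
    have h1 : is_hom (\1%VF : 'Hom(U, U)) by move=> m a; rewrite !id_lfunE.
    have [u iu0|r hr rE] := factor_surj hi imi h1.
      rewrite id_lfunE; move/eqP/lker0P: i_inj; apply.
      by rewrite iu0 linear0.
    by apply: (projective_retract pP hi hr) => u; rewrite rE id_lfunE.
  have [g hg g0] := dual_hom f.
  have [j hj jE] := incl_hom (lker_submodule hg).
  have pK : projective (submodule (lker_submodule hg)).
    apply: (kernel_to_dual_projective (R := R) gl ext pP hg hj).
      by apply/eqP/lker0P => u v; rewrite !jE; apply: subvs_inj.
    apply/vspaceP => y; apply/memv_imgP/idP => [[z _ ->]|yK].
      by rewrite jE subvsP.
    by exists (vsproj _ y); rewrite ?memvf // jE vsprojK.
  have [|c hc cE] := corestrict (lker_submodule hg) hi.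
    apply/subvP => _ /memv_imgP[u _ ->]; rewrite memv_ker; apply/eqP/g0 => c.
    apply/eqP; rewrite -memv_ker -hi; apply: (subvP fi); exact/memv_img/memvf.
  apply: (IHn _ _ c _ pK hc).
    (* The dimension drops because the kernel of [g] misses [x]: acting by 1 recovers [f x], which
       is nonzero. *)
    rewrite -ltnS (leq_trans _ dP) // dimvf.
    change (\dim (lker g) < \dim {:P})%N.
    rewrite ltnNge; apply: contra fx => dk.
    have : x \in lker g.
      suff -> : lker g = fullv by rewrite memvf.
      by apply/eqP; rewrite eqEdim subvf.
    by rewrite memv_ker => /eqP/g0/(_ 1); rewrite ract1 => ->.
  move/eqP/lker0P: i_inj => i_inj; apply/eqP/lker0P => u v uv.
  by apply: i_inj; rewrite -!cE uv.
move=> P U hU pP; have [i hi iE] := incl_hom hU.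
apply: (main _ P _ i (leqnn _) pP hi).
by apply/eqP/lker0P => u v; rewrite !iE; apply: subvs_inj.
Qed.

End Hereditary.

(** * Cluster-tilted algebras *)

Section Transport.

Variables (k : fieldType) (A B : falgType k) (f : 'Hom(A, B)).
Hypotheses (f1 : f 1 = 1) (fM : forall x y, f (x * y) = f x * f y).

Section Restrict.
Variable M : rmodule B.

Definition res_act (m : M) (a : A) : M := ract m (f a).

Fact res_act_linl a : linear (res_act^~ a). Proof. exact: ract_linl. Qed.

Fact res_act_linr m : linear (res_act m).
Proof. by move=> c a b; rewrite /res_act linearP ract_linr. Qed.

Fact res_act1 m : res_act m 1 = m. Proof. by rewrite /res_act f1 ract1. Qed.

Fact res_actA m a b : res_act (res_act m a) b = res_act m (a * b).
Proof. by rewrite /res_act ractA fM. Qed.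

Definition restrict : rmodule A :=
  RModule res_act_linl res_act_linr res_act1 res_actA.

End Restrict.

End Transport.

Section Iso.

Variables (k : fieldType) (A B : falgType k) (f : 'Hom(A, B)) (g : 'Hom(B, A)).
Hypotheses (f1 : f 1 = 1) (fM : forall x y, f (x * y) = f x * f y).
Hypotheses (g1 : g 1 = 1) (gM : forall x y, g (x * y) = g x * g y).
Hypotheses (fK : cancel f g) (gK : cancel g f).

Lemma projective_restrict (P : rmodule B) :
  projective P -> projective (restrict f1 fM P).
Proof.
move=> pP M N h u hh sh hu.
have [||v hv vE] := pP (restrict g1 gM M) (restrict g1 gM N) h u _ sh.
- by move=> m b; apply: hh.
- by move=> p b; rewrite -{1}[b]gK; apply: hu.
exists v => // p a; rewrite -[a in RHS]fK; exact: (hv p (f a)).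
Qed.

End Iso.

Lemma hereditary_iso (k : fieldType) (A B : falgType k)
    (f : 'Hom(A, B)) (g : 'Hom(B, A)) :
  f 1 = 1 -> (forall x y, f (x * y) = f x * f y) ->
  cancel f g -> cancel g f -> hereditary A -> hereditary B.
Proof.
move=> f1 fM fK gK herA P U hU pP.
have g1 : g 1 = 1 by rewrite -f1 fK.
have gM x y : g (x * y) = g x * g y by apply: (can_inj fK); rewrite fM !gK.
have hU' : is_submodule (M := restrict f1 fM P) U by move=> m a; apply: hU.
have pU := herA (restrict f1 fM P) U hU' (projective_restrict g1 gM fK gK pP).
have {}pU := projective_restrict (f1 := g1) (fM := gM) f1 fM gK fK pU.
pose i : 'Hom(subvs_of U, subvs_of U) := \1%VF.
have iE u : i u = u by rewrite id_lfunE.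
(* Restricting along [f] and then along [g] keeps the carrier, but the action agrees with the
   original one only through [gK]; the identity therefore has to serve as an isomorphism. *)
have actE (u : subvs_of U) b :
    ract (u : restrict g1 gM (submodule hU')) b = ract (u : submodule hU) b.
  apply: subvs_inj; rewrite [RHS](sub_ractE hU).
  rewrite [LHS](sub_ractE hU').
  by change (ract (vsval u : P) (f (g b)) = ract (vsval u) b); rewrite gK.
pose V := restrict g1 gM (submodule hU').
apply: (@projective_retract _ _ V (submodule hU) i i pU) => [u b|u b|u].
- by rewrite !iE actE.
- by rewrite !iE actE.
- by rewrite !iE.
Qed.

(** * Ext bimodules and the grading derivation of a trivial extension *)

Section ClusterTilted.

Variable k : fieldType.

Lemma lact0l (C : falgType k) (M : bimodule C) (m : M) : lact 0 m = 0.
Proof.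
by have := lact_linl m (-1) 0 0; rewrite scaler0 addr0 scaleN1r addNr.
Qed.

Lemma lact0r (C : falgType k) (M : bimodule C) (c : C) : lact c (0 : M) = 0.
Proof.
by have := lact_linr c (-1) (0 : M) 0; rewrite scaler0 addr0 scaleN1r addNr.
Qed.

(* The central element acts on a resolution of X by right multiplication, which
   lifts its left action on X. *)
Lemma Ext_bimodule_symmetric (C : falgType k) n (X Y E : bimodule C) (z : C) :
  (forall c, z * c = c * z) ->
  (forall x : X, lact z x = ract x z) -> (forall y : Y, lact z y = ract y z) ->
  is_Ext_bimodule n X Y E -> forall m : E, lact z m = ract m z.
Proof.
move=> zC zX zY [R [pi [pi_surj _ piL piR]]] m; have [f hf <-] := pi_surj m.
pose l i : 'Hom(R i, R i) := linfun (fun u => ract u z).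
have lE i : l i =1 fun u => ract u z by apply/linfunE/ract_linl.
have hl : is_lift (R := R) (lmul_lfun X z) l.
  split=> [i u a||i]; first by rewrite !lE !ractA zC.
    by apply/lfunP => u; rewrite !comp_lfunE lE lmul_lfunE zX -res_aug_hom.
  by apply/lfunP => u; rewrite !comp_lfunE !lE -res_d_hom.
rewrite -(piR _ _ _ hf hl) -piL //; congr (pi _); apply/lfunP => u.
by rewrite !comp_lfunE lE lmul_lfunE zY hf.1.
Qed.

Lemma cluster_tilted_hereditary (B : falgType k) :
  cluster_tilted B -> HH1_zero B -> hereditary B.
Proof.
move=> [C [E [[H [T [herH [_ ext _] endT]]] extE [phi [phi_bij phi1 phiM]]]]] hh.
have [psi phiK psiK] := phi_bij.
have phi_inj := bij_inj phi_bij.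
have phi1E b : phi b = ((phi b).1, (phi b).2) by case: (phi b).
have [D DE] : exists D : 'End(B), forall b, phi (D b) = (0, (phi b).2).
  have [g gE] : exists g : 'End(B), g =1 fun b => psi (0, (phi b).2).
    apply: lfun_of => c u v; apply: phi_inj; rewrite [RHS]linearP /= !psiK linearP.
    by apply: injective_projections => //=; rewrite scaler0 addr0.
  by exists g => b; rewrite gE psiK.
(* [D] is the derivation counting the degree in E. *)
have [|x xE] := hh D.
  move=> a b; apply: phi_inj; rewrite linear0 linearD linearB /= !phiM !DE /= !phiM.
  apply: injective_projections => /=; first by rewrite mulr0 mul0r subr0 addr0.
  by rewrite ract0r lact0l addr0 add0r opprD addrA subrr add0r addNr.
have DP c m : phi (D (psi (c, m))) = (0, m) by rewrite DE psiK.
have xC c : (phi x).1 * c = c * (phi x).1.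
  have := DP c 0; rewrite xE linearB /= !phiM psiK /= => /(congr1 fst) /= /eqP.
  by rewrite subr_eq0 => /eqP.
have E0 (m : E) : m = 0.
  have := DP 0 m; rewrite xE linearB /= !phiM psiK /= => /(congr1 snd) /= <-.
  rewrite lact0l (Ext_bimodule_symmetric xC _ _ extE) => [||y].
  - by rewrite ract0r add0r addr0 subrr.
  - by move=> h; apply/lfunP => c; rewrite [RHS]dual_ractE [LHS]dual_lactE xC.
  - exact: xC.
have [R [pi [_ piE _ _]]] := extE.
have herC : hereditary C.
  apply: (@kernels_hereditary _ _ R) => [|h hh'].
    exact: End_kernels_projective endT.
  by apply/(piE _ hh')/E0.
have [f fE] : exists f : 'Hom(C, B), f =1 fun c => psi (c, 0).
  apply: lfun_of => c u v; apply: phi_inj; rewrite [RHS]linearP /= !psiK.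
  by apply: injective_projections => //=; rewrite scaler0 addr0.
have [g gE] : exists g : 'Hom(B, C), g =1 fun b => (phi b).1.
  by apply: lfun_of => c u v; rewrite linearP.
apply: (hereditary_iso (f := f) (g := g) _ _ _ _ herC) => [|c d|c|b].
- by apply: phi_inj; rewrite fE psiK.
- by apply: phi_inj; rewrite phiM !fE !psiK /= ract0l lact0r addr0.
- by rewrite gE fE psiK.
- by apply: phi_inj; rewrite fE psiK gE phi1E [(phi b).2]E0.
Qed.

End ClusterTilted.

(** * The radical *)

Section Radical.

Variables (k : fieldType) (B : falgType k).
Implicit Types (x y : B) (U V : {vspace B}).

(** Left multiplication by [y] is injective, hence surjective by finite dimension. *)
Lemma mulr1_comm x y : x * y = 1 -> y * x = 1.
Proof.
move=> xy1; have inj : lker (amull y) == 0%VS.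
  by apply/lker0P => a b; rewrite !lfunE /= => ab; rewrite -[a]mul1r -xy1 -mulrA ab mulrA xy1 mul1r.
have /memv_imgP[z _] : 1 \in limg (amull y) by rewrite lker0_limgf ?memvf.
rewrite lfunE /= => yz; rewrite [RHS]yz; congr (y * _).
by rewrite -[LHS]mulr1 yz mulrA xy1 mul1r.
Qed.

Lemma right_ideal_mul U x b : right_ideal U -> x \in U -> x * b \in U.
Proof. by move=> hU xU; apply: hU. Qed.

Lemma right_ideal1 U : right_ideal U -> 1 \in U -> U = fullv.
Proof.
move=> hU U1; apply/vspaceP => x; rewrite memvf -[x]mul1r.
exact: right_ideal_mul.
Qed.

Lemma maximal_right_ideal_exists U : right_ideal U -> U <> fullv ->
  exists2 V, maximal_right_ideal V & (U <= V)%VS.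
Proof.
have [n dn] := ubnP (\dim {:B} - \dim U); elim: n U dn => // n IHn U dU hU Uf.
have [Umax|] := classic (maximal_right_ideal U); first by exists U.
move=> nmax; have [W [hW UW WU Wf]] :
    exists W, [/\ right_ideal W, (U <= W)%VS, W <> U & W <> fullv].
  apply: NNPP => nW; apply: nmax; split=> // V hV UV.
  have [->|VU] := eqVneq V U; first by left.
  have [->|Vf] := eqVneq V fullv; first by right.
  by case: nW; exists V; split=> //; apply/eqP.
have [|V Vmax WV] := IHn W _ hW Wf; last by exists V => //; apply: subv_trans WV.
have : (\dim U < \dim W)%N.
  rewrite ltn_neqAle dimvS // andbT; apply: contra_notN WU => dUW.
  by apply/esym/eqP; rewrite eqEdim UW (eqP dUW) /=.
have := dimvS (subvf W); move: dU; lia.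
Qed.

Variables (J : {vspace B}) (hJ : is_radical J).

(** If the right ideal generated by 1 - x were proper, a maximal right ideal above it would contain
    [x] as well, and so 1. *)
Lemma radical_unit x : x \in J -> exists2 y, (1 - x) * y = 1 & y * (1 - x) = 1.
Proof.
move=> xJ; suff [y xy] : exists y, (1 - x) * y = 1.
  by exists y => //; apply: mulr1_comm.
have [Uf|/eqP Uf] := eqVneq (limg (amull (1 - x))) fullv.
  have : 1 \in limg (amull (1 - x)) by rewrite Uf memvf.
  by case/memv_imgP => y _; rewrite lfunE; exists y.
have [V Vmax UV] := maximal_right_ideal_exists (@principal_right_ideal _ _ (1 - x)) Uf.
have [hV Vf _] := Vmax; case: Vf; apply: right_ideal1 => //.
rewrite -(subrK x 1) memvD //; last exact: (hJ x).1.
apply: (subvP UV); apply/memv_imgP; exists 1; first exact: memvf.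
by rewrite lfunE /= mulr1.
Qed.

Lemma radical_mulr x b : x \in J -> x * b \in J.
Proof.
move=> xJ; apply/hJ => U Umax; have [hU _ _] := Umax.
by apply: right_ideal_mul => //; apply: (hJ x).1.
Qed.

Lemma memv_add_principal U x : right_ideal U -> right_ideal (U + limg (amull x))%VS.
Proof.
move=> hU _ a /memv_addP[u uU [_ /memv_imgP[y _ ->] ->]].
rewrite [ract _ _]mulrDl; apply: memv_add; first exact: right_ideal_mul.
by apply: (@principal_right_ideal _ _ x); apply/memv_img/memvf.
Qed.

Lemma maximal_add U x : maximal_right_ideal U -> x \notin U ->
  forall y, exists2 u, u \in U & exists b, y = u + x * b.
Proof.
move=> [hU _ Umax] xU y.
have [VU|Vf] := Umax _ (memv_add_principal (x := x) hU) (addvSl _ _).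
  case/negP: xU; rewrite -VU; apply: (subvP (addvSr _ _)).
  by apply/memv_imgP; exists 1; rewrite ?memvf // lfunE /= mulr1.
have : y \in (U + limg (amull x))%VS by rewrite Vf memvf.
case/memv_addP => u uU [_ /memv_imgP[b _ ->] ->]; exists u => //.
by exists b; rewrite lfunE.
Qed.

(** [J] is defined through right ideals only. For [b] outside a maximal right ideal U, the elements
    y with b y in U form a maximal right ideal again. *)
Lemma radical_mull x b : x \in J -> b * x \in J.
Proof.
move=> xJ; apply/hJ => U Umax; have [hU Uf _] := Umax.
have [bU|bU] := boolP (b \in U); first exact: right_ideal_mul.
have inW y : (y \in (amull b @^-1: U)%VS) = (b * y \in U).
  by rewrite -memv_preim lfunE.
suff Wmax : maximal_right_ideal (amull b @^-1: U)%VS.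
  by rewrite -inW; apply: (hJ x).1.
split.
- move=> y a; rewrite !inW [ract y a]/(y * a) mulrA; exact: right_ideal_mul.
- by move=> Wf; case/negP: bU; rewrite -[b]mulr1 -inW Wf memvf.
move=> V hV WV; have [VW|] := boolP (V <= (amull b @^-1: U))%VS.
  by left; apply/eqP; rewrite eqEsubv VW.
case/subvPn => v vV; rewrite inW => bv; right; apply/vspaceP => y.
rewrite memvf; have [u uU [c byE]] := maximal_add Umax bv (b * y).
rewrite -(subrK (v * c) y) memvD //; last exact: right_ideal_mul.
by apply: (subvP WV); rewrite inW mulrBr byE mulrA addrK.
Qed.

Lemma nilpotent_unit x n : x ^+ n = 0 -> exists y, (1 - x) * y = 1.
Proof.
move=> xn; exists (\sum_(i < n) x ^+ i); apply: oppr_inj.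
by rewrite -mulNr opprB -subrX1 xn sub0r.
Qed.

(** If [x] avoided a maximal right ideal, then 1 = u + x b with u in that ideal, although u = 1 - x
    b is invertible. *)
Lemma nil_radical x : (forall b, exists n, (x * b) ^+ n = 0) -> x \in J.
Proof.
move=> nil; apply/hJ => U Umax; apply: contraT => xU; have [hU Uf _] := Umax.
have [u uU [b bE]] := maximal_add Umax xU 1; have [n xn] := nil b.
have [y xy] := nilpotent_unit xn; case: Uf; apply: right_ideal1 => //.
have -> : 1 = u * y by rewrite -xy bE addrK.
exact: right_ideal_mul.
Qed.

Lemma line_prodvP x U y :
  reflect (exists2 u, u \in U & y = x * u) (y \in (<[x]> * U)%VS).
Proof.
apply: (iffP idP) => [|[u uU ->]]; last by rewrite memv_mul ?memv_line.
suff : (<[x]> * U <= amull x @: U)%VS.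
  by move/subvP => /[apply] /memv_imgP[u uU ->]; exists u; rewrite ?lfunE.
apply/prodvP => _ u /vlineP[c ->] uU.
by rewrite -scalerAl memvZ //; apply/memv_imgP; exists u; rewrite ?lfunE.
Qed.

Lemma prodv_radical_mulr U x y : x \in (U * J)%VS -> x * y \in (U * J)%VS.
Proof.
suff : (U * J <= amulr y @^-1: (U * J))%VS.
  by move/subvP => /[apply]; rewrite -memv_preim lfunE.
apply/prodvP => a b aU bJ; rewrite -memv_preim lfunE /= -mulrA.
by rewrite memv_mul // radical_mulr.
Qed.

(** Generators are removed one at a time: up to the others, [x] equals [x * j] with [j] in [J], and
    1 - j is invertible. *)
Lemma nakayama U : (U <= U * J)%VS -> U = 0%VS.
Proof.
have [X ->] : exists X, U = <<X>>%VS by exists (vbasis U); rewrite (span_basis (vbasisP U)).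
elim: X => [|x X IHX] XJ; first by rewrite span_nil.
have JJ : (J * J <= J)%VS by apply/prodvP => a b aJ _; apply: radical_mulr.
have xX : x \in (<<X>> * J)%VS.
  have : x \in (<<x :: X>> * J)%VS by apply: (subvP XJ); rewrite memv_span ?mem_head.
  rewrite span_cons prodvDl => /memv_addP[u /line_prodvP[j jJ ->] [w wXJ xE]].
  have [y jy _] := radical_unit jJ.
  have -> : x = w * y by rewrite -[LHS]mulr1 -jy mulrA mulrBr mulr1 {1}xE addrC addKr.
  exact: prodv_radical_mulr.
have sub : (<<x :: X>> <= <<X>> * J)%VS.
  apply: (subv_trans XJ); rewrite span_cons prodvDl subv_add subvv andbT.
  apply: (subv_trans (y := (<<X>> * J * J)%VS)); last by rewrite -prodvA prodvSr.
  by apply: prodvSl; rewrite -memvE.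
have X0 : <<X>>%VS = 0%VS.
  by apply: IHX; apply: subv_trans sub; rewrite span_cons addvSr.
by apply/eqP; rewrite -subv0 (subv_trans sub) // X0 prod0v subvv.
Qed.

Lemma radical_nilpotent : exists n, (J ^+ n = 0)%VS.
Proof.
have JJ : (J * J <= J)%VS by apply/prodvP => a b aJ _; apply: radical_mulr.
(* The powers decrease only from the first one on: [J ^+ 0] is the line spanned by 1. *)
have JS n : (J ^+ n.+2 <= J ^+ n.+1)%VS.
  by rewrite !expvSr -prodvA prodvSr.
have [n Jn] : exists n, (J ^+ n <= J ^+ n.+1)%VS.
  apply: NNPP => nJ.
  have dJ n : (\dim (J ^+ n.+1) + n <= \dim {:B})%N.
    elim: n => [|n IHn]; first by rewrite addn0 dimvS ?subvf.
    suff : (\dim (J ^+ n.+2) < \dim (J ^+ n.+1))%N by lia.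
    rewrite ltnNge; apply/negP => dn; apply: nJ; exists n.+1.
    have : (J ^+ n.+2 == J ^+ n.+1)%VS by rewrite eqEdim JS.
    by move/eqP ->; apply: subvv.
  by have := dJ (\dim {:B}).+1; lia.
by exists n; apply: nakayama; rewrite -expvSr.
Qed.

End Radical.

(** * Corners at primitive idempotents *)

Section Corner.

Variables (k : closedFieldType) (B : falgType k).
Implicit Types (x y e f : B).

Lemma annihilating_poly x : exists2 p : {poly k}, p != 0 & horner_alg x p = 0.
Proof.
pose X := [tuple x ^+ i | i < (dim B).+1].
have nf : ~~ free X.
  apply/negP; rewrite /free size_tuple => /eqP dX.
  by have := dimvS (subvf <<X>>%VS); rewrite dX dimvf ltnn.
have [c [c0 [i ci]]] : exists c : 'I_(dim B).+1 -> k,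
    \sum_i c i *: X`_i = 0 /\ exists i, c i != 0.
  apply: NNPP => nc; case/negP: nf; apply/freeP => c c0 i; apply/eqP/negPn/negP => ci.
  by apply: nc; exists c; split=> //; exists i.
exists (\poly_(i < (dim B).+1) c (inord i)).
  apply: contraNneq ci => p0; have := congr1 (fun p : {poly k} => p`_i) p0.
  by rewrite coef_poly ltn_ord inord_val coef0 => ->.
rewrite poly_def linear_sum -[RHS]c0; apply: eq_bigr => j _ /=.
by rewrite linearZ /= rmorphXn /= horner_algX inord_val nth_mktuple mulr_algl.
Qed.

(* A coprime factorization of an annihilating polynomial of [x] splits [e] into
   two orthogonal idempotents, one of which must vanish. *)
Lemma corner_eigen e x : primitive_idempotent e -> e * x = x -> x * e = x ->
  exists lam n, (x - lam *: e) ^+ n = 0.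
Proof.
move=> [ee e0 prim] ex xe.
have ce q : e * horner_alg x q = horner_alg x q * e.
  elim/poly_ind: q => [|q c IHq]; first by rewrite rmorph0 mulr0 mul0r.
  rewrite rmorphD rmorphM /= horner_algX horner_algC mulrDr mulrDl.
  by rewrite mulrA IHq -!mulrA ex xe -scalerAr mulr1 -scalerAl mul1r.
(* Evaluation at [x] in the corner algebra, whose unit is [e]. *)
pose ev q := e * horner_alg x q.
have evD p q : ev (p + q) = ev p + ev q by rewrite /ev rmorphD mulrDr.
have evM p q : ev (p * q) = ev p * ev q.
  by rewrite /ev rmorphM /= [RHS]mulrA -(mulrA e) -ce !mulrA ee.
have ev1 : ev 1 = e by rewrite /ev rmorph1 mulr1.
have [p p0 px] := annihilating_poly x.
have {px} : ev p = 0 by rewrite /ev px mulr0.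
have [n] := ubnP (size p); elim: n p p0 => // n IHn p p0 sp evp.
have [sp1|sp1] := eqVneq (size p) 1.
  move/eqP/size_poly1P: sp1 => [c c0 pE]; case/negP: e0; apply/eqP.
  move: evp; rewrite pE /ev horner_algC mulr_algr => /eqP.
  by rewrite scaler_eq0 (negPf c0) => /eqP.
have /closed_rootP[lam lamP] := sp1.
have [m [q]] := multiplicity_XsubC p lam; rewrite p0 /= => ql pE.
have m0 : (0 < m)%N.
  by rewrite lt0n; apply: contraTneq lamP => m0; rewrite pE m0 expr0 mulr1.
have /Bezout_eq1_coprimepP[[u v] /= uv] : coprimep (('X - lam%:P) ^+ m) q.
  by rewrite coprimep_sym coprimep_expr // coprimep_XsubC.
set r := ('X - lam%:P) ^+ m in pE uv.
have fg : ev (u * r) * ev (v * q) = 0.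
  by rewrite -evM [u * r * _](_ : _ = u * v * p) ?evM ?evp ?mulr0 // pE; ring.
have gf : ev (v * q) * ev (u * r) = 0.
  by rewrite -evM [v * q * _](_ : _ = u * v * p) ?evM ?evp ?mulr0 // pE; ring.
have eE : e = ev (u * r) + ev (v * q) by rewrite -evD uv ev1.
have idf : idempotent_elt (ev (u * r)).
  by rewrite /idempotent_elt -[LHS]addr0 -fg -mulrDr -eE -ev1 -evM mulr1.
have idg : idempotent_elt (ev (v * q)).
  by rewrite /idempotent_elt -[LHS]add0r -gf addrC -mulrDr addrC -eE -ev1 -evM mulr1.
have [f0|g0] := prim _ _ idf idg fg gf eE.
  (* Here [r] already annihilates [x] in the corner; in the other case [q] does, and its degree is
     smaller. *)
  exists lam, m.
  have -> : x - lam *: e = ev ('X - lam%:P).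
    by rewrite /ev rmorphB /= horner_algX horner_algC mulrBr ex mulr_algr.
  have -> : ev ('X - lam%:P) ^+ m = ev r.
    rewrite /r; case: m m0 {r uv pE fg gf eE idf idg f0} => // m _.
    by elim: m => [|m IHm]; rewrite ?expr1 // exprS IHm -evM -exprS.
  rewrite -[r]mul1r -uv mulrDl evD evM f0 mul0r add0r.
  by rewrite [v * q * _](_ : _ = v * p) ?evM ?evp ?mulr0 // pE; ring.
apply: (IHn q).
- by apply: contraNneq p0 => q0; rewrite pE q0 mul0r.
- have q0 : q != 0 by apply: contraNneq p0 => q0; rewrite pE q0 mul0r.
  move: sp; rewrite pE size_Mmonic ?monic_exp ?monicXsubC // size_exp_XsubC.
  move: m0; lia.
- rewrite -[q]mul1r -uv mulrDl evD [ev (v * q * q)]evM g0 mul0r addr0.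
  by rewrite [u * r * _](_ : _ = u * p) ?evM ?evp ?mulr0 // pE; ring.
Qed.

(** The corner is local: [x] is nilpotent if its eigenvalue is 0, and otherwise a nonzero multiple
    of [e] plus a nilpotent element, hence invertible. *)
Lemma corner_dichotomy e x : primitive_idempotent e -> e * x = x -> x * e = x ->
  (exists n, x ^+ n = 0) \/ (exists2 w, e * w * e = w & x * w = e).
Proof.
move=> pe ex xe; have [lam [n xn]] := corner_eigen pe ex xe.
have [ee _ _] := pe; have [l0|l0] := eqVneq lam 0.
  by left; exists n; rewrite l0 scale0r subr0 in xn.
right; set y := x - _ in xn; pose z := - lam^-1 *: y.
have [v zv] : exists v, (1 - z) * v = 1.
  by apply: (@nilpotent_unit _ _ _ n); rewrite exprZn xn scaler0.
have xE : x = lam *: (e * (1 - z)).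
  rewrite mulrBr mulr1 /z -scalerAr scaleNr opprK scalerDr scalerA mulfV //.
  by rewrite scale1r /y mulrBr ex -scalerAr ee addrC subrK.
exists (e * (lam^-1 *: v) * e).
  by rewrite !mulrA ee -!mulrA ee.
have xv : x * v = lam *: e by rewrite xE -scalerAl -mulrA zv mulr1.
by rewrite !mulrA xe -scalerAr xv scalerA mulVf // scale1r ee.
Qed.

Variables (J : {vspace B}) (hJ : is_radical J).

Lemma nil_corner e x b n : e * x = x -> (x * b * e) ^+ n = 0 -> exists m, (x * b) ^+ m = 0.
Proof.
move=> ex zn; exists n.+1.
suff -> : (x * b) ^+ n.+1 = (x * b * e) ^+ n * (x * b) by rewrite zn mul0r.
elim: n {zn} => [|n IHn]; first by rewrite expr1 mul1r.
by rewrite exprSr IHn exprSr -!mulrA (mulrA e) ex.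
Qed.

(** Were some [x * b * e] invertible in the corner, [x] would have a right inverse [c] there, and
    [e * (x ^+ n * c ^+ n)] would be [e] for every [n]. *)
Lemma nil_corner_radical e x n : primitive_idempotent e -> e * x = x -> x * e = x ->
  x ^+ n = 0 -> x \in J.
Proof.
move=> pe ex xe xn; have [ee e0 _] := pe; apply: (nil_radical hJ) => b.
have [||[m zm]|[w wE xw]] := @corner_dichotomy e (x * b * e) pe.
- by rewrite !mulrA ex.
- by rewrite -!mulrA ee.
- exact: nil_corner zm.
have [c xc] : exists c, x * c = e.
  by exists (e * (b * e * w)); rewrite mulrA xe -[RHS]xw !mulrA.
case/negP: e0; apply/eqP; suff <- : e * (x ^+ n * c ^+ n) = e by rewrite xn mul0r mulr0.
have ce m : x ^+ m * e = e * x ^+ m.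
  by apply/esym/commrX; rewrite /GRing.comm ex.

elim: n {xn} => [|n IHn]; first by rewrite !expr0 !mulr1.
by rewrite exprSr exprS -!mulrA (mulrA x c) xc (mulrA _ e) ce -mulrA mulrA ee.
Qed.

Lemma corner_radical e x : primitive_idempotent e ->
  exists lam, e * x * e - lam *: e \in J.
Proof.
move=> pe; have [ee _ _] := pe.
have ex : e * (e * x * e) = e * x * e by rewrite !mulrA ee.
have xe : e * x * e * e = e * x * e by rewrite -mulrA ee.
have [lam [n xn]] := corner_eigen pe ex xe; exists lam.
apply: (nil_corner_radical pe _ _ xn).
  by rewrite mulrBr ex -scalerAr ee.
by rewrite mulrBl xe -scalerAl ee.
Qed.

Lemma principal_hom e f y : f * y = y ->
  exists2 h : 'Hom(principal_module e, principal_module f),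
    is_hom h & forall u, vsval (h u) = y * vsval u.
Proof.
move=> fy; have yU b : y * b \in limg (amull f).
  by apply/memv_imgP; exists (y * b); rewrite ?memvf // lfunE /= mulrA fy.
have [||h hh hE] := @hom_of _ _ (principal_module e) (principal_module f)
    (fun u => vsproj _ (y * vsval u)).
- move=> c u v; apply: subvs_inj; rewrite linearP /= !vsprojK //.
  by rewrite mulrDr -scalerAr.
- move=> u a; apply: subvs_inj.
  have uaU : @ract _ _ (regular_rmodule B) (vsval u) a \in limg (amull e).
    by apply: principal_right_ideal; apply: subvsP.
  rewrite [RHS](sub_ractE (@principal_right_ideal _ _ f)) !vsprojK //.
  exact: mulrA.
by exists h => // u; rewrite hE vsprojK.
Qed.

Lemma principal_fix e (u : principal_module e) :
  idempotent_elt e -> e * vsval u = vsval u.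
Proof. by move=> ee; have /memv_imgP[v _ ->] := subvsP u; rewrite lfunE /= mulrA ee. Qed.

(** If some [x' * b * e] is invertible in the corner of [e], then [x'] has a right inverse [y]. The
    product [y * x'] is a nonzero idempotent in the corner of [f], hence [f], and left
    multiplications by [y] and [x'] identify the two projective modules. *)
Lemma offdiag_radical e f x : primitive_idempotent e -> primitive_idempotent f ->
  ~ is_iso (principal_module e) (principal_module f) -> e * x * f \in J.
Proof.
move=> pe pf niso; have [ee e0 _] := pe; have [ff f0 prim] := pf.
set x' := e * x * f; have ex : e * x' = x' by rewrite /x' !mulrA ee.
have xf : x' * f = x' by rewrite /x' -mulrA ff.
clearbody x'.
apply: (nil_radical hJ) => b.
have [||[m zm]|[w wE xw]] := @corner_dichotomy e (x' * b * e) pe.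
- by rewrite !mulrA ex.
- by rewrite -!mulrA ee.
- exact: nil_corner zm.
have [y [xy fy ye]] : exists y, [/\ x' * y = e, f * y = y & y * e = y].
  exists (f * (b * e * w)); split; first by rewrite mulrA xf -[RHS]xw !mulrA.
    by rewrite mulrA ff.
  by rewrite -wE -!mulrA ee.
have yxf : y * x' = f.
  have yxyx : idempotent_elt (y * x').
    by rewrite /idempotent_elt mulrA -(mulrA y) xy ye.
  have fyx : f * (y * x') = y * x' by rewrite mulrA fy.
  have yxF : y * x' * f = y * x' by rewrite -mulrA xf.
  have [||||yx0|fyx0] := prim (y * x') (f - y * x') yxyx.
  - rewrite /idempotent_elt mulrBl !mulrBr ff fyx yxF yxyx subrr subr0.
    by [].
  - by rewrite mulrBr yxF yxyx subrr.
  - by rewrite mulrBl fyx yxyx subrr.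
  - by rewrite addrC subrK.
  - case/negP: e0; rewrite -[e]ee -{1}xy -xy mulrA -(mulrA x') yx0.
    by rewrite mulr0 mul0r.
  - by apply/esym/eqP; rewrite -subr_eq0 fyx0.
case: niso.
have [h hh hE] := principal_hom e fy; have [g _ gE] := principal_hom f ex.
exists h => //; exists g => u; apply: subvs_inj.
  by rewrite gE hE mulrA xy principal_fix.
by rewrite hE gE mulrA yxf principal_fix.
Qed.

End Corner.

(** * Gabriel presentations *)

(** Replaces a description of [B] as a path algebra modulo an admissible ideal: [pres_gen] and
    [pres_free] make the arrows a basis of J/J^2, while [pres_diag] and [pres_off] say that the
    vertices span [B] modulo [J]. *)
Record presentation (k : fieldType) (B : falgType k) (Q : quiver)
    (e : vertex Q -> B) (al : arrow Q -> B) (J : {vspace B}) : Prop := Presentation {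
  pres_orth : forall i j, e i * e j = if i == j then e i else 0;
  pres_sum : \sum_i e i = 1;
  pres_neq0 : forall i, e i != 0;
  pres_src : forall a, e (src a) * al a = al a;
  pres_tgt : forall a, al a * e (tgt a) = al a;
  pres_rad : forall a, al a \in J;
  rad_mulr : forall x b, x \in J -> x * b \in J;
  rad_mull : forall x b, x \in J -> b * x \in J;
  rad_nilp : exists n, (J ^+ n = 0)%VS;
  pres_gen : forall x, x \in J -> exists c : arrow Q -> k,
    x - \sum_a c a *: al a \in (J * J)%VS;
  pres_free : forall c : arrow Q -> k,
    \sum_a c a *: al a \in (J * J)%VS -> forall a, c a = 0;
  pres_diag : forall i x, exists lam, e i * x * e i - lam *: e i \in J;
  pres_off : forall i j x, i != j -> e i * x * e j \in J }.

Section Peirce.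

Variables (k : fieldType) (B : falgType k).

Lemma cornerP (e f x : B) (U : {vspace B}) :
  reflect (exists2 u, u \in U & x = e * u * f) (x \in (<[e]> * U * <[f]>)%VS).
Proof.
apply: (iffP memv_cosetP) => [[_ /line_prodvP[u uU ->] ->]|[u uU ->]].
  by exists u.
by exists (e * u) => //; apply/line_prodvP; exists u.
Qed.

Lemma peirce (I : finType) (e : I -> B) x :
  \sum_i e i = 1 -> x = \sum_i \sum_j e i * x * e j.
Proof.
move=> e1; rewrite -[LHS]mul1r -[LHS]mulr1 -e1 !mulr_suml.
by apply: eq_bigr => i _; rewrite mulr_sumr.
Qed.

End Peirce.

Section Presentation.

Variables (k : closedFieldType) (B : falgType k) (Q : quiver).

Lemma ordinary_presentation : basic_algebra B -> is_ordinary_quiver B Q ->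
  exists (e : vertex Q -> B) al J, presentation e al J.
Proof.
move=> basicB [e [J [cpe hJ card_arr]]]; have [pe eo e1] := cpe.
have orth i j : e i * e j = if i == j then e i else 0.
  by have [->|/eo ->] := eqVneq i j; first by have [] := pe j.
pose A i j := [set a : arrow Q | (src a == i) && (tgt a == j)].
pose W2 i j := (<[e i]> * (J * J) * <[e j]>)%VS.
(* A complement of e_i J^2 e_j in e_i J e_j. Its dimension is the number of arrows from [i] to [j],
   so an arrow can be sent to the basis vector given by its rank among its parallels. *)
pose D i j := (<[e i]> * J * <[e j]> :\: W2 i j)%VS.
pose al a := (vbasis (D (src a) (tgt a)))`_(index a (enum (A (src a) (tgt a)))).
have mulrJ := radical_mulr hJ; have mullJ := radical_mull hJ.
have JJl b x : x \in (J * J)%VS -> b * x \in (J * J)%VS.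
  suff : (J * J <= amull b @^-1: (J * J))%VS.
    by move/subvP => /[apply]; rewrite -memv_preim lfunE.
  apply/prodvP => a a' aJ a'J; rewrite -memv_preim lfunE /= mulrA.
  by rewrite memv_mul ?mullJ.
have W2J i j : (W2 i j <= <[e i]> * J * <[e j]>)%VS.
  by apply/prodvSl/prodvSr/prodvP => a b aJ _; apply: mulrJ.
have dD i j : \dim (D i j) = #|A i j|.
  rewrite card_arr -(dimv_cap_compl (<[e i]> * J * <[e j]>) (W2 i j)).
  by rewrite (capv_idPr (W2J i j)) addKn.
have alD a i j : a \in A i j -> al a \in D i j.
  rewrite inE => /andP[/eqP <- /eqP <-]; apply/vbasis_mem/mem_nth.
  by rewrite size_tuple dD cardE index_mem mem_enum inE !eqxx.
have [X XE Xbasis] : exists2 X : forall i j, #|A i j|.-tuple B,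
    forall i j l, (X i j)`_(l : 'I_#|A i j|) = al (enum_val l)
    & forall i j, basis_of (D i j) (X i j).
  exists (fun i j => [tuple al (enum_val l) | l < #|A i j|]) => i j => [l|].
    by rewrite nth_mktuple.
  suff -> : [tuple al (enum_val l) | l < #|A i j|] = vbasis (D i j) :> seq B.
    exact: vbasisP.
  apply: (@eq_from_nth _ 0); first by rewrite !size_tuple dD.
  move=> r; rewrite size_tuple => rA.
  rewrite -[r]/(nat_of_ord (Ordinal rA)) nth_mktuple; set l := Ordinal rA.
  have := enum_valP l; rewrite inE => /andP[/eqP si /eqP tj].
  rewrite /al si tj (enum_val_nth (enum_val l)) index_uniq ?enum_uniq //.
  by rewrite -cardE.
have spanD i j x : x \in D i j -> exists c : arrow Q -> k,
    x = \sum_(a in A i j) c a *: al a.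
  move=> /(coord_basis (Xbasis i j)) xE.
  exists (fun a => \sum_(l | enum_val l == a) coord (X i j) l x).
  rewrite [LHS]xE [RHS]big_enum_val /=; apply: eq_bigr => l _.
  by rewrite (big_pred1 l) ?XE // => r; rewrite (inj_eq enum_val_inj).
have freeD i j (c : arrow Q -> k) : \sum_(a in A i j) c a *: al a = 0 ->
    forall a, a \in A i j -> c a = 0.
  rewrite big_enum_val => c0 a aA; rewrite -(enum_rankK_in aA aA).
  move/basis_free/freeP: (Xbasis i j) => /(_ (fun l => c (enum_val l))); apply.
  by rewrite -[RHS]c0; apply: eq_bigr => l _; rewrite XE.
have al_corner a : al a \in (<[e (src a)]> * J * <[e (tgt a)]>)%VS.
  by apply: (subvP (diffvSl _ (W2 (src a) (tgt a)))); apply: alD; rewrite inE !eqxx.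
have al_src a : e (src a) * al a = al a.
  by have /cornerP[u _ ->] := al_corner a; rewrite !mulrA orth eqxx.
have al_tgt a : al a * e (tgt a) = al a.
  by have /cornerP[u _ ->] := al_corner a; rewrite -!mulrA orth eqxx.
exists e, al, J; split=> //.
- by move=> i; have [] := pe i.
- move=> a; have /cornerP[u uJ ->] := al_corner a; exact/mulrJ/mullJ.
- exact: radical_nilpotent hJ.
- move=> x xJ.
  have /fin_all_exists[c cE] (ij : vertex Q * vertex Q) : exists c : arrow Q -> k,
      e ij.1 * x * e ij.2 - \sum_(a in A ij.1 ij.2) c a *: al a \in (J * J)%VS.
    case: ij => i j /=.
    have : e i * x * e j \in (<[e i]> * J * <[e j]>)%VS by apply/cornerP; exists x.
    rewrite -(addv_diff_cap (<[e i]> * J * <[e j]>)%VS (W2 i j)) (capv_idPr (W2J i j)).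
    case/memv_addP => u /spanD[c ->] [w /cornerP[v vJ ->] ->]; exists c.
    by rewrite addrC addKr; apply/(prodv_radical_mulr hJ)/JJl.
  exists (fun a => c (src a, tgt a) a).
  rewrite (partition_big (fun a => (src a, tgt a)) xpredT) //=.
  rewrite -(pair_bigA _ (fun i j => \sum_(a | (src a, tgt a) == (i, j)) _)) /=.
  rewrite {1}(peirce x e1) -sumrB memv_suml // => i _.
  rewrite -sumrB memv_suml // => j _.
  rewrite (_ : \sum_(a | _) _ = \sum_(a in A i j) c (i, j) a *: al a); first exact: (cE (i, j)).
  by apply: eq_big => [a|a /eqP[-> ->]] //; rewrite inE xpair_eqE.
- move=> c c0 b; apply: (freeD (src b) (tgt b) c); last by rewrite inE !eqxx.
  set s := \sum_(a in _) _.
  have sD : s \in D (src b) (tgt b) by apply: memv_suml => a /alD; apply: memvZ.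
  suff : s \in (D (src b) (tgt b) :&: W2 (src b) (tgt b))%VS.
    by rewrite capv_diff memv0 => /eqP.
  rewrite memv_cap sD; apply/cornerP; exists (\sum_a c a *: al a) => //.
  rewrite mulr_sumr mulr_suml (bigID (mem (A (src b) (tgt b)))) /= [X in _ + X]big1.
    rewrite addr0; apply: eq_bigr => a; rewrite inE => /andP[/eqP <- /eqP <-].
    by rewrite -scalerAr -scalerAl al_src al_tgt.
  move=> a; rewrite inE negb_and -scalerAr -scalerAl => /orP[sa|ta].
    by rewrite -(al_src a) !mulrA orth eq_sym (negPf sa) !mul0r scaler0.
  by rewrite -(al_tgt a) -!mulrA orth (negPf ta) !mulr0 scaler0.
- move=> i x; exact: corner_radical (pe i).
- move=> i j x ij; apply: offdiag_radical => //; exact: basicB cpe _ _ ij.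
Qed.

End Presentation.

(** * Words in the arrows *)

Section Words.

Variables (k : fieldType) (B : falgType k) (Q : quiver).
Variables (e : vertex Q -> B) (al : arrow Q -> B) (J : {vspace B}).
Hypothesis P : presentation e al J.
Implicit Types (x y : B) (U : {vspace B}) (p : pred (vertex Q)).

(** The factor [fullv] makes the term of index 0 the whole algebra rather than the line of 1, so
    that inductions along the filtration can start there. *)
Definition radpow n : {vspace B} := (J ^+ n * fullv)%VS.

Lemma radpow0 : radpow 0 = fullv. Proof. by rewrite /radpow prod1v. Qed.

Lemma radpowS n : radpow n.+1 = (J * radpow n)%VS.
Proof. by rewrite /radpow expvSl prodvA. Qed.

Lemma radpow1 : radpow 1 = J.
Proof.
rewrite /radpow expv1; apply/eqP; rewrite eqEsubv; apply/andP; split.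
  by apply/prodvP => x y xJ _; apply: (rad_mulr P).
by apply/subvP => x xJ; rewrite -[x]mulr1 memv_mul ?memvf.
Qed.

Lemma radpow_nilp : exists n, radpow n = 0%VS.
Proof. by have [n Jn] := rad_nilp P; exists n; rewrite /radpow Jn prod0v. Qed.

Lemma mem_radpow0 x : (forall n, x \in radpow n) -> x = 0.
Proof.
by move=> xJ; have [n Jn] := radpow_nilp; have := xJ n; rewrite Jn memv0 => /eqP.
Qed.

Lemma radpow_mulS n x y : x \in J -> y \in radpow n -> x * y \in radpow n.+1.
Proof. by rewrite radpowS; apply: memv_mul. Qed.

Lemma corner_mod_rad i j x : exists lam, e i * x * e j - lam *: e i \in J.
Proof.
have [<-|ij] := eqVneq i j; first exact: (pres_diag P).
by exists 0; rewrite scale0r subr0; apply: (pres_off P).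
Qed.

(** The substitute for the spanning of [B] by paths: [U] exhausts each layer of the radical
    filtration, because arrows generate [J] modulo J^2, and the filtration ends at 0. *)
Lemma words_ind U : (forall i, e i \in U) ->
  (forall a x, x \in U -> al a * x \in U) -> U = fullv.
Proof.
move=> Ue Ual.
have step n : (radpow n <= U + radpow n.+1)%VS.
  elim: n => [|n IHn].
    apply/subvP => x _; rewrite (peirce x (pres_sum P)) radpow1.
    apply: memv_suml => i _; apply: memv_suml => j _.
    have [lam lamP] := corner_mod_rad i j x.
    by rewrite -(subrK (lam *: e i) (_ * _)) addrC memv_add ?memvZ.
  rewrite radpowS; apply/prodvP => y z yJ zn.
  have [c cP] := pres_gen P yJ; rewrite -(subrK (\sum_a c a *: al a) y) mulrDl.
  apply: memvD.
    by apply: (subvP (addvSr _ _)); rewrite !radpowS prodvA memv_mul.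
  rewrite mulr_suml; apply: memv_suml => a _; rewrite -scalerAl memvZ //.
  have /memv_addP[u uU [z' z'n ->]] := subvP IHn z zn.
  by rewrite mulrDr memv_add ?Ual ?radpow_mulS ?(pres_rad P).
have full n : (fullv <= U + radpow n)%VS.
  elim: n => [|n IHn]; first by rewrite radpow0 addvSr.
  apply: (subv_trans IHn); rewrite subv_add addvSl; exact: step.
have [n Jn] := radpow_nilp; apply/eqP; rewrite eqEsubv subvf.
by have := full n; rewrite Jn addv0.
Qed.

Definition idem p : B := \sum_(v | p v) e v.

Lemma idem_mule p j : idem p * e j = if p j then e j else 0.
Proof.
rewrite /idem mulr_suml big_mkcond (bigD1 j) //= (pres_orth P) eqxx big1 ?addr0 //.
by move=> i ij; rewrite (pres_orth P) (negPf ij) if_same.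
Qed.

Lemma e_mul_idem p j : e j * idem p = if p j then e j else 0.
Proof.
rewrite /idem mulr_sumr big_mkcond (bigD1 j) //= (pres_orth P) eqxx big1 ?addr0 //.
by move=> i ij; rewrite (pres_orth P) eq_sym (negPf ij) if_same.
Qed.

Lemma idem_mul_al p a : idem p * al a = if p (src a) then al a else 0.
Proof.
by rewrite -(pres_src P) mulrA idem_mule; case: ifP; rewrite ?mul0r.
Qed.

Lemma al_mul_idem p a : al a * idem p = if p (tgt a) then al a else 0.
Proof.
by rewrite -(pres_tgt P) -mulrA e_mul_idem; case: ifP; rewrite ?mulr0.
Qed.

(** The sum of the vertices of one component commutes with every arrow, hence is a central
    idempotent. *)
Lemma connected_quiver : connected_algebra B ->
  forall i j : vertex Q, connect (@adjacent Q) i j.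
Proof.
move=> connB i j; pose p := connect (@adjacent Q) i.
have pa a : p (src a) = p (tgt a).
  apply/idP/idP => ip; apply: (connect_trans ip); apply: connect1;
  by apply/existsP; exists a; rewrite !eqxx ?orbT.
have cent x : idem p * x = x * idem p.
  have /(_ _ _)/vspaceP/(_ x) := @words_ind 'C[idem p]%VS; rewrite memvf.
  move=> H; apply/esym/cent1vP; rewrite H //.
    by move=> v; apply/cent1vP; rewrite idem_mule e_mul_idem.
  move=> a y /cent1vP yp; apply/cent1vP.
  by rewrite -mulrA yp !mulrA idem_mul_al al_mul_idem pa.
have pp : idem p * idem p = idem p.
  rewrite {2 3}/idem mulr_sumr; apply: eq_bigr => v pv.
  by rewrite idem_mule pv.
have [p0|p1] := connB _ pp cent.
  by have := idem_mule p i; rewrite p0 mul0r /p connect0 => /esym/eqP;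
     rewrite (negPf (pres_neq0 P i)).
have := idem_mule p j; rewrite p1 mul1r; case: ifP => // _ /eqP.
by rewrite (negPf (pres_neq0 P j)).
Qed.

End Words.

(** * The two sides of an arrow in a tree *)

Section TreePotential.

Variable Q : quiver.

Definition adj_avoiding (a : arrow Q) : rel (vertex Q) := fun i j =>
  [exists b : arrow Q, (b != a) &&
     (((src b == i) && (tgt b == j)) || ((src b == j) && (tgt b == i)))].

(* In a tree, the component of [src a] once [a] is removed. *)
Definition src_side (a : arrow Q) : pred (vertex Q) :=
  connect (adj_avoiding a) (src a).

Lemma src_side_other a b : b != a -> src_side a (src b) = src_side a (tgt b).
Proof.
move=> ba; apply/idP/idP => ab; apply: (connect_trans ab); apply: connect1;
by apply/existsP; exists b; rewrite ba !eqxx ?orbT.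
Qed.

Lemma src_side_src a : src_side a (src a). Proof. exact: connect0. Qed.

(** A simple path of vertices uses each edge once, since a repeated edge would repeat a vertex. The
    chain condition is stated with arbitrary darts at both ends, so that the path can be closed up
    by [a]. *)
Lemma path_darts a p x : path (adj_avoiding a) x p -> uniq (x :: p) ->
  exists ds : seq (dart Q),
  [/\ map (@dart_src Q) ds = belast x p, uniq (map fst ds),
      {in ds, forall d, [/\ d.1 != a, src d.1 \in x :: p & tgt d.1 \in x :: p]}
    & forall d d', dart_tgt d = x -> dart_src d' = last x p ->
        path (fun d d' => dart_tgt d == dart_src d') d (rcons ds d')].
Proof.
elim: p x => [|y p IHp] x /=.
  move=> _ _; exists [::]; split=> // d d' dx d'x /=.
  by rewrite dx d'x eqxx.
case/andP => /existsP[b /andP[ba bxy]] yp /andP[xyp uyp].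
have [ds [srcs uds inds chain]] := IHp y yp uyp.
have [s [ds_ dt_]] : exists s, dart_src (b, s) = x /\ dart_tgt (b, s) = y.
  by case/orP: bxy => /andP[/eqP <- /eqP <-]; [exists true | exists false].
exists ((b, s) :: ds); split=> /=.
- by rewrite srcs ds_.
- rewrite uds andbT; apply: contra xyp => /mapP[d dds bd].
  have [_ sd td] := inds d dds; rewrite -ds_ /dart_src /= bd.
  by case: s {ds_ dt_}.
- move=> d; rewrite inE => /orP[/eqP ->|/inds[da sd td]] /=; last first.
    by split=> //; rewrite in_cons ?sd ?td orbT.
  rewrite ba; case/orP: bxy => /andP[/eqP -> /eqP ->];
  by rewrite !inE !eqxx ?orbT.
- by move=> d d' dx d'l; rewrite dx ds_ eqxx chain.
Qed.

(** A path joining the ends of [a] without using it would close up to a cycle by [a] traversed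
    backwards. *)
Lemma src_side_tgt a : is_tree Q -> ~~ src_side a (tgt a).
Proof.
case=> _ _ acyclic; apply/negP => /connectP[p0 p0P p0t].
case/shortenP: p0P p0t => p pP up _ pt.
have [ds [srcs uds inds chain]] := path_darts pP up.
apply: (acyclic ((a, false) :: ds)); split=> //=.
- by apply: chain.
- by rewrite srcs /dart_src /= pt -rcons_uniq -lastI.
- rewrite uds andbT; apply/mapP => -[d dds ad].
  by have [/eqP] := inds d dds; rewrite ad.
Qed.

End TreePotential.

(** * Trees *)

Section Derivations.

Variables (k : fieldType) (B : falgType k) (Q : quiver).
Variables (e : vertex Q -> B) (al : arrow Q -> B) (J : {vspace B}).
Hypothesis P : presentation e al J.
Implicit Types (x y : B) (U : {vspace B}).

Lemma derivation_eq0 (f : 'End(B)) : (forall x y, f (x * y) = x * f y + f x * y) ->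
  (forall i, f (e i) = 0) -> (forall a, f (al a) = 0) -> f = 0.
Proof.
move=> fM fe fal; apply/lfunP => x; rewrite zero_lfunE; apply/eqP; rewrite -memv_ker.
rewrite (@words_ind _ _ _ _ _ _ P (lker f)) ?memvf // => [i|a y].
  by rewrite memv_ker fe.
by rewrite !memv_ker fM fal mul0r addr0 => /eqP ->; rewrite mulr0.
Qed.

Definition cut_mul (u v : B) : 'End(B) := (amull u \o amulr v)%VF.

Lemma cut_mulE u v x : cut_mul u v x = u * (x * v).
Proof. by rewrite comp_lfunE !lfunE. Qed.

Section Tree.
Hypothesis treeQ : is_tree Q.

Let E a := idem e (src_side a).

Lemma E_src a : E a * al a = al a.
Proof. by rewrite /E (idem_mul_al P) src_side_src. Qed.

Lemma E_tgt a : al a * E a = 0.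
Proof. by rewrite /E (al_mul_idem P) (negPf (src_side_tgt _ treeQ)). Qed.

Lemma E_comm a b : b != a -> E a * al b = al b * E a.
Proof.
by move=> ba; rewrite /E (idem_mul_al P) (al_mul_idem P) (src_side_other ba).
Qed.

Lemma E_e a i : E a * e i = e i * E a.
Proof. by rewrite /E (idem_mule P) (e_mul_idem P). Qed.

Lemma E_e_src a : E a * e (src a) = e (src a).
Proof. by rewrite /E (idem_mule P) src_side_src. Qed.

Lemma E_e_tgt a : E a * e (tgt a) = 0.
Proof. by rewrite /E (idem_mule P) (negPf (src_side_tgt _ treeQ)). Qed.

(** Only [a] joins the two sides, and it leads from the source side to the other: no word comes
    back. *)
Lemma tree_no_return a x : e (tgt a) * x * e (src a) = 0.
Proof.
suff full : lker (cut_mul (1 - E a) (E a)) = fullv.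
  have := memvf x; rewrite -full memv_ker cut_mulE => /eqP x0.
  have te : e (tgt a) = e (tgt a) * (1 - E a).
    by rewrite mulrBr mulr1 -E_e E_e_tgt subr0.
  by rewrite te -E_e_src -!mulrA (mulrA x) (mulrA (1 - _)) x0 mul0r mulr0.
apply: (words_ind P) => [i|b y]; rewrite !memv_ker !cut_mulE.
  rewrite -E_e mulrBl mul1r /E; case: (boolP (src_side a i)) => ai.
    by rewrite !(idem_mule P) ai !(idem_mule P) ai subrr.
  by rewrite (idem_mule P) (negPf ai) mulr0 subrr.
move=> /eqP y0; have [->|ba] := eqVneq b a.
  by rewrite !mulrA mulrBl mul1r E_src subrr !mul0r.
by rewrite !mulrA mulrBl mul1r E_comm // -{1}[al b]mulr1 -mulrBr -!mulrA y0 mulr0.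
Qed.

(** A word at [i] that begins with an arrow [a] would have to return from the target of [a] to its
    source. *)
Lemma tree_diag i x : exists lam, e i * x * e i = lam *: e i.
Proof.
suff full : (cut_mul (e i) (e i) @^-1: <[e i]>)%VS = fullv.
  have := memvf x; rewrite -full -memv_preim cut_mulE mulrA => /vlineP[lam xE].
  by exists lam.
apply: (words_ind P) => [j|a y _]; rewrite -memv_preim cut_mulE.
  rewrite (pres_orth P); case: eqP => [->|_]; last by rewrite mulr0 mem0v.
  by rewrite (pres_orth P) eqxx memv_line.
rewrite -(pres_src P) !mulrA (pres_orth P); case: eqP => [->|_]; last by rewrite !mul0r mem0v.
by rewrite (pres_src P) -(pres_tgt P) -!mulrA (mulrA (e (tgt a))) tree_no_return mulr0 mem0v.
Qed.

Lemma tree_line a x : exists lam, e (src a) * x * e (tgt a) = lam *: al a.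
Proof.
(* The ideal generated by the arrow contains every word that crosses to the target side; between the
   ends of [a] it reduces to a line, as both end corners are lines. *)
pose Z := (fullv * <[al a]> * fullv)%VS.
have full : (cut_mul (E a) (1 - E a) @^-1: Z)%VS = fullv.
  apply: (words_ind P) => [i|b y]; rewrite -!memv_preim !cut_mulE.
    rewrite mulrBr mulr1 -E_e mulrBr /E !(idem_mule P).
    by case: ifP => ai; rewrite ?(idem_mule P) ?ai ?mulr0 ?subrr ?mem0v.
  move=> yZ; have [->|ba] := eqVneq b a.
    rewrite -mulrA mulrA E_src -[al a]mul1r.
    by rewrite !memv_mul ?memvf ?memv_line.
  rewrite -mulrA mulrA E_comm // -mulrA; move: yZ; set w := _ * _ => wZ.
  have : (fullv * Z <= Z)%VS by rewrite /Z !prodvA !prodvSl // subvf.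
  by move/subvP; apply; rewrite memv_mul ?memvf.
have subZ : (Z <= cut_mul (e (src a)) (e (tgt a)) @^-1: <[al a]>)%VS.
  rewrite /Z -prodvA; apply/prodvP => y w _ /line_prodvP[z _ ->].
  rewrite -memv_preim cut_mulE -(pres_src P) -(pres_tgt P).
  have [l1 l1E] := tree_diag (src a) y; have [l2 l2E] := tree_diag (tgt a) z.
  have -> : e (src a) * (y * (e (src a) * (al a * e (tgt a)) * z) * e (tgt a)) =
      (e (src a) * y * e (src a)) * al a * (e (tgt a) * z * e (tgt a)) by rewrite !mulrA.
  rewrite l1E l2E -scalerAl (pres_src P) -scalerAl -scalerAr (pres_tgt P).
 by rewrite (pres_src P) !memvZ // memv_line.
have : cut_mul (E a) (1 - E a) x \in Z by rewrite memv_preim full memvf.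
move/(subvP subZ); rewrite -memv_preim !cut_mulE => /vlineP[lam xE]; exists lam.
rewrite -xE !mulrA -E_e E_e_src -!mulrA; congr (_ * (_ * _)).
by rewrite mulrBl mul1r E_e_tgt subr0.
Qed.

Lemma tree_HH1 : HH1_zero B.
Proof.
move=> f hf.
have fM x y : f (x * y) = x * f y + f x * y.
  by apply/eqP; rewrite eq_sym -subr_eq0 -(hf x y) addrAC.
pose ad x : 'End(B) := amulr x - amull x.
have adE x b : ad x b = b * x - x * b by rewrite add_lfunE opp_lfunE !lfunE.
have adM x y z : ad z (x * y) = x * ad z y + ad z x * y.
  by rewrite !adE mulrBr mulrBl !mulrA addrA subrK.
(* Subtracting the inner derivation of [- s] makes the derivation vanish on the vertices, so that it
   maps each arrow into its own corner, a line. *)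
pose s := \sum_i f (e i) * e i.
have se j : s * e j = f (e j) * e j.
  rewrite mulr_suml (bigD1 j) //= -mulrA (pres_orth P) eqxx big1 ?addr0 // => i ij.
  by rewrite -mulrA (pres_orth P) (negPf ij) mulr0.
have es j : e j * s + f (e j) = f (e j) * e j.
  rewrite -[f (e j) in LHS]mulr1 -(pres_sum P) !mulr_sumr -big_split /=.
  have term i : e j * (f (e i) * e i) + f (e j) * e i = f (e j * e i) * e i.
    by rewrite fM mulrDl -!mulrA (pres_orth P i i) eqxx.
  rewrite (eq_bigr _ (fun i _ => term i)) (bigD1 j) //= (pres_orth P) eqxx big1 ?addr0 //.
  by move=> i ij; rewrite (pres_orth P) eq_sym (negPf ij) linear0 mul0r.
pose x0 := - s.
have x0E j : ad x0 (e j) = f (e j).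
  by rewrite adE /x0 mulrN mulNr opprK se -es addKr.
pose g := f - ad x0.
have gM x y : g (x * y) = x * g y + g x * y.
  by rewrite !add_lfunE !opp_lfunE fM adM mulrBr mulrBl opprD addrACA.
have ge i : g (e i) = 0 by rewrite add_lfunE opp_lfunE x0E subrr.
have /fin_all_exists[c cE] a : exists lam : k, g (al a) = lam *: al a.
  have [lam lamE] := tree_line a (g (al a)).
  have gs : g (al a) = e (src a) * g (al a).
    by rewrite -{1}(pres_src P) gM ge mul0r addr0.
  have gt : g (al a) = g (al a) * e (tgt a).
    by rewrite -{1}(pres_tgt P) gM ge mulr0 add0r.
  by exists lam; rewrite -lamE -gs -gt.
(* Among the [E b], only [E a] fails to commute with [al a]; the sign follows the convention b x - x
   b of the coboundaries. *)
pose y0 := - \sum_a c a *: E a.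
have y0e i : ad y0 (e i) = 0.
  rewrite adE /y0 mulrN mulNr opprK mulr_sumr mulr_suml addrC -sumrB big1 // => a _.
  by rewrite -scalerAl -scalerAr E_e subrr.
have y0al a : ad y0 (al a) = c a *: al a.
  rewrite adE /y0 mulrN mulNr opprK mulr_sumr mulr_suml addrC -sumrB (bigD1 a) //=.
  rewrite -scalerAl -scalerAr E_src E_tgt scaler0 subr0 big1 ?addr0 // => b ba.
  by rewrite -scalerAl -scalerAr E_comm 1?eq_sym // subrr.
have g0 : g - ad y0 = 0.
  apply: derivation_eq0 => [x y|i|a].
  - by rewrite !(add_lfunE g) !opp_lfunE gM adM mulrBr mulrBl opprD addrACA.
  - by rewrite add_lfunE opp_lfunE ge y0e subrr.
  - by rewrite add_lfunE opp_lfunE cE y0al subrr.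
exists (x0 + y0) => b; have := congr1 (fun h : 'End(B) => h b) g0.
rewrite zero_lfunE !add_lfunE !opp_lfunE !adE => /eqP.
rewrite -addrA -opprD subr_eq0 => /eqP ->.
by rewrite mulrDr mulrDl opprD addrACA.
Qed.

End Tree.

End Derivations.

(** * Hereditary algebras *)

Section Hereditary.

Variables (k : fieldType) (B : falgType k) (Q : quiver).
Variables (e : vertex Q -> B) (al : arrow Q -> B) (J : {vspace B}).
Hypothesis P : presentation e al J.
Implicit Types (x y : B) (U : {vspace B}).

Let S : {vspace B} := (\sum_i <[e i]>)%VS.

Lemma mem_e_span i : e i \in S.
Proof. by apply: (subvP (sumv_sup i _ (subvv _))); rewrite ?memv_line. Qed.

Lemma rad_cap_span : (J :&: S = 0)%VS.
Proof.
have eJ i : e i \notin J.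
  apply/negP => eJ; case/negP: (pres_neq0 P i); apply/eqP/(mem_radpow0 P) => n.
  elim: n => [|n IHn]; first by rewrite (radpow0 J) memvf.
  have -> : e i = e i * e i by rewrite (pres_orth P) eqxx.
  exact: radpow_mulS.
apply/eqP; rewrite -subv0; apply/subvP => x /memv_capP[xJ /memv_sumP[x_ x_e xE]].
rewrite xE big1 ?mem0v // => i _; have /vlineP[c cE] := x_e i isT; rewrite cE.
have [->|c0] := eqVneq c 0; first by rewrite scale0r.
case/negP: (eJ i); have : e i * x \in J by apply: (rad_mull P).
rewrite xE mulr_sumr (bigD1 i) //= big1 ?addr0 => [|j ji].
  rewrite cE -scalerAr (pres_orth P) eqxx => /(memvZ c^-1).
  by rewrite scalerA mulVf // scale1r.
have /vlineP[d ->] := x_e j isT.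
by rewrite -scalerAr (pres_orth P) eq_sym (negPf ji) scaler0.
Qed.

(** The normalisation of [y] at the targets makes the coefficients candidates for unique
    coordinates, since [al a] absorbs [e (tgt a)]. *)
Lemma rad_span x : x \in J -> exists2 y : arrow Q -> B,
  forall a, e (tgt a) * y a = y a & x = \sum_a al a * y a.
Proof.
move=> xJ; pose V := (\sum_a <[al a]> * fullv)%VS.
have VJ : (V <= J)%VS.
  by apply/subv_sumP => a _; apply/prodvP => _ y /vlineP[c ->] _;
     rewrite -scalerAl memvZ //; apply/(rad_mulr P)/(pres_rad P).
have full : (S + V)%VS = fullv.
  apply: (words_ind P) => [i|a y _]; first by apply/(subvP (addvSl _ _))/mem_e_span.
  apply: (subvP (addvSr _ _)); apply: (subvP (sumv_sup a _ (subvv _))) => //.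
  by rewrite memv_mul ?memv_line ?memvf.
have /memv_addP[s sS [v vV xE]] : x \in (S + V)%VS by rewrite full memvf.
have s0 : s = 0.
  apply/eqP; rewrite -memv0 -rad_cap_span memv_cap sS andbT.
  by rewrite -(addrK v s) -xE memvB // (subvP VJ).
have /memv_sumP[v_ v_P vE] := vV.
have /fin_all_exists[y yE] a : exists y, v_ a = al a * y.
  by have /line_prodvP[y _ ->] := v_P a isT; exists y.
exists (fun a => e (tgt a) * y a) => [a|].
  by rewrite mulrA (pres_orth P) eqxx.
rewrite xE s0 add0r vE; apply: eq_bigr => a _.
by rewrite yE mulrA (pres_tgt P).
Qed.

(** Modulo [J] each coefficient is a multiple of a vertex, and the relation becomes a linear one
    between arrows modulo J^2. *)
Lemma syzygy_rad (r : arrow Q -> B) : (forall a, e (tgt a) * r a = r a) ->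
  \sum_a al a * r a = 0 -> forall a, r a \in J.
Proof.
move=> er r0; have /fin_all_exists[lam lamP] a : exists lam, r a - lam *: e (tgt a) \in J.
  have [lam lamP] := pres_diag P (tgt a) (r a); exists lam.
  rewrite -[r a]mulr1 -(pres_sum P) mulr_sumr (bigD1 (tgt a)) //= addrAC.
  apply: memvD; first by rewrite -{1}er.
  apply: memv_suml => j ja; rewrite -er.
  by apply: (pres_off P); rewrite eq_sym.
suff lam0 a : lam a = 0 by move=> a; have := lamP a; rewrite lam0 scale0r subr0.
apply: (pres_free P); rewrite (_ : \sum_b _ = - \sum_b al b * (r b - lam b *: e (tgt b))).
  by rewrite memvN memv_suml // => b _; rewrite memv_mul ?(pres_rad P).
under [in RHS]eq_bigr do rewrite mulrBr -scalerAr (pres_tgt P).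
by rewrite sumrB r0 sub0r opprK.
Qed.

Hypothesis herB : hereditary B.

(** A dual basis, on the arrows, of the projective right ideal [J]; the coordinates are extended
    linearly to [B] and normalised at the targets. *)
Lemma rad_coordinates : exists bt : arrow Q -> 'End(B),
  [/\ forall a x, e (tgt a) * bt a x = bt a x,
      forall x, x \in J -> x = \sum_a al a * bt a x
    & forall a x b, x \in J -> bt a (x * b) = bt a x * b].
Proof.
have hU : is_submodule (M := regular_rmodule B) J by move=> x b; apply: (rad_mulr P).
have pJ : projective (submodule hU).
  by apply: herB; apply: projective_regular.
pose x_ (l : 'I_#|arrow Q|) : submodule hU := vsproj J (al (enum_val l)).
have actE (u : submodule hU) b : vsval (ract u b) = vsval u * b.
  exact: (sub_ractE hU).
have x_E l : vsval (x_ l) = al (enum_val l) by rewrite vsprojK ?(pres_rad P).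
have sumE (u : submodule hU) (y : arrow Q -> B) : vsval u = \sum_a al a * y a ->
    u = \sum_l ract (x_ l) (y (enum_val l)).
  move=> uE; apply: subvs_inj; rewrite uE linear_sum /=.
  rewrite (reindex _ (onW_bij _ (@enum_val_bij _))) /=.
  by apply: eq_bigr => l _; rewrite actE x_E.
have [u|phi hphi phiE] := projective_dual_basis (x := x_) pJ.
  have [y _ yE] := rad_span (subvsP u); exists (fun l => y (enum_val l)).
  exact: sumE.
have /fin_all_exists[bt btE] a : exists f : 'End(B),
    f =1 fun x => e (tgt a) * phi (enum_rank a) (vsproj J x).
  by apply: lfun_of => c u v; rewrite !linearP /= mulrDr -scalerAr.
exists bt; split=> [a x|x xJ|a x b xJ]; rewrite ?btE.
- by rewrite mulrA (pres_orth P) eqxx.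
- have := congr1 vsval (phiE (vsproj J x)); rewrite vsprojK // linear_sum /= => {1}->.
  rewrite [RHS](reindex _ (onW_bij _ (@enum_val_bij _))) /=.
  apply: eq_bigr => l _; rewrite actE x_E btE enum_valK.
  by rewrite mulrA (pres_tgt P).
- rewrite -mulrA; congr (_ * _).
  have -> : vsproj J (x * b) = ract (vsproj J x : submodule hU) b.
    by apply: subvs_inj; rewrite actE !vsprojK ?(rad_mulr P).
  by rewrite hphi.
Qed.

(** The matrix [R] measures how far the coordinates of the arrows are from the identity. Its columns
    are relations, so its entries lie in [J], and y = R y pushes [y] into every power of [J]. *)
Lemma al_relation_free (y : arrow Q -> B) : (forall a, e (tgt a) * y a = y a) ->
  \sum_a al a * y a = 0 -> forall a, y a = 0.
Proof.
have [bt [ebt btE btM]] := rad_coordinates; move=> ey y0.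
pose R a b := (if a == b then e (tgt a) else 0) - bt a (al b).
have RJ a b : R a b \in J.
  apply: (@syzygy_rad (R^~ b)) => [c|].
    by rewrite /R mulrBr ebt; case: eqP => _; rewrite ?(pres_orth P) ?eqxx ?mulr0.
  rewrite /R; under eq_bigr do rewrite mulrBr.
  rewrite sumrB -btE ?(pres_rad P) // (bigD1 b) //= eqxx (pres_tgt P) big1 ?addr0 ?subrr //.
  by move=> c cb; rewrite (negPf cb) mulr0.
have yR a : y a = \sum_b R a b * y b.
  rewrite /R; under eq_bigr do rewrite mulrBl.
  rewrite sumrB (bigD1 a) //= eqxx ey big1 ?addr0 => [|b ba]; last first.
    by rewrite eq_sym (negPf ba) mul0r.
  under eq_bigr do rewrite -btM ?(pres_rad P) //.
  by rewrite -linear_sum y0 linear0 subr0.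
move=> a; apply: (mem_radpow0 P) => n; elim: n a => [|n IHn] a.
  by rewrite (radpow0 J) memvf.
by rewrite yR; apply: memv_suml => b _; apply: radpow_mulS.
Qed.

(** Coordinates on [J] being unique, the rules that D kills the vertices and that D (al a y) = al a
    (c_a y + D y) for normalised y define D recursively. *)
Lemma weighted_derivation (c : arrow Q -> k) : exists D : 'End(B),
  [/\ forall x y, D (x * y) = x * D y + D x * y,
      forall i, D (e i) = 0 & forall a, D (al a) = c a *: al a].
Proof.
have [bt [ebt btE btM]] := rad_coordinates.
pose pj : 'End(B) := daddv_pi J S.
have pjJ x : x \in J -> pj x = x by apply: daddv_pi_id rad_cap_span.
have pje i : pj (e i) = 0.
  have := daddv_pi_add rad_cap_span (_ : e i \in (J + S)%VS).
  rewrite (daddv_pi_id (U := S)) ?mem_e_span ?(capvC S) ?rad_cap_span //.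
  move/(_ (subvP (addvSr _ _) _ (mem_e_span i)))/eqP.
  by rewrite -subr_eq0 addrK => /eqP.
(* [D] is the fixed point of [step], reached after finitely many iterations since
   each of them gains a power of the radical. *)
pose step (D : 'End(B)) : 'End(B) :=
  \sum_a (amull (al a) \o ((c a *: \1%VF + D) \o (bt a \o pj)))%VF.
have stepE D x : step D x = \sum_a al a * (c a *: bt a (pj x) + D (bt a (pj x))).
  rewrite sum_lfunE; apply: eq_bigr => a _.
  by rewrite !comp_lfunE lfunE /= add_lfunE scale_lfunE id_lfunE.
have [D DE] : exists D, D = step D.
  pose Dn n := iter n step 0; have DnS n : Dn n.+1 = step (Dn n) by [].
  have Dn_rad n x : Dn n.+1 x - Dn n x \in radpow J n.
    elim: n x => [|n IHn] x; first by rewrite radpow0 memvf.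
    rewrite (DnS n.+1) {2}(DnS n) !stepE -sumrB; apply: memv_suml => a _.
    rewrite -mulrBr; apply: radpow_mulS; first exact: (pres_rad P).
    by rewrite opprD addrACA subrr add0r.
  have [n Jn] := radpow_nilp P; exists (Dn n); apply/lfunP => x.
  by have := Dn_rad n x; rewrite Jn memv0 subr_eq0 => /eqP.
have De i : D (e i) = 0.
  by rewrite DE stepE pje big1 // => a _; rewrite !linear0 addr0 mulr0.
have DalE b y : e (tgt b) * y = y -> D (al b * y) = al b * (c b *: y + D y).
  move=> ey; have byJ : al b * y \in J by apply/(rad_mulr P)/(pres_rad P).
  have btal a : bt a (al b * y) = if a == b then y else 0.
    apply/eqP; rewrite -subr_eq0; apply/eqP; move: a.
    apply: al_relation_free => [a|].
      by rewrite mulrBr ebt; case: eqP => [->|_]; rewrite ?ey ?mulr0.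
    under eq_bigr do rewrite mulrBr.
    rewrite sumrB -btE // (bigD1 b) //= eqxx big1 ?addr0 ?subrr // => a ab.
    by rewrite (negPf ab) mulr0.
  rewrite {1}DE stepE pjJ // (bigD1 b) //= btal eqxx big1 ?addr0 // => a ab.
  by rewrite btal (negPf ab) !linear0 addr0 mulr0.
have De_mul i y : D (e i * y) = e i * D y.
  suff full : lker ((D \o amull (e i))%VF - (amull (e i) \o D)%VF) = fullv.
    have := memvf y; rewrite -full memv_ker add_lfunE opp_lfunE subr_eq0.
    by rewrite !comp_lfunE !lfunE => /eqP.
  apply: (words_ind P) => [j|b z _];
    rewrite memv_ker add_lfunE opp_lfunE subr_eq0 !comp_lfunE !lfunE /=.
    by rewrite (pres_orth P) De mulr0; case: ifP; rewrite ?De ?linear0.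
  have {1 2}-> : al b * z = al b * (e (tgt b) * z) by rewrite mulrA (pres_tgt P).
  have ez : e (tgt b) * (e (tgt b) * z) = e (tgt b) * z by rewrite mulrA (pres_orth P) eqxx.
  have eal : e i * al b = if i == src b then al b else 0.
    by rewrite -(pres_src P) mulrA (pres_orth P); case: eqP => [->|_]; rewrite ?mul0r.
  move: (e (tgt b) * z) ez => w ew.
  rewrite (DalE b) // !mulrA eal; case: ifP => _; last by rewrite !mul0r linear0.
  by rewrite DalE.
have Dal b z : D (al b * z) = c b *: (al b * z) + al b * D z.
  rewrite -(pres_tgt P) -mulrA DalE; last by rewrite mulrA (pres_orth P) eqxx.
  by rewrite De_mul mulrDr -scalerAr !mulrA !(pres_tgt P).
have D1 : D 1 = 0 by rewrite -(pres_sum P) linear_sum big1 // => i _; apply: De.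
exists D; split=> // [x y|a]; last first.
  by have := Dal a 1; rewrite mulr1 D1 mulr0 addr0.
(* The Leibniz rule is checked by induction on the word in the left factor. *)
suff full : lker ((D \o amulr y)%VF - (amulr (D y) + (amulr y \o D)%VF)) = fullv.
  have := memvf x; rewrite -full memv_ker add_lfunE opp_lfunE subr_eq0.
  by rewrite !add_lfunE !comp_lfunE !lfunE => /eqP.
apply: (words_ind P) => [j|b z];
  rewrite !memv_ker !add_lfunE !opp_lfunE !subr_eq0 !add_lfunE !comp_lfunE !lfunE /=.
  by rewrite De De_mul mul0r addr0.
move=> /eqP zy; rewrite -!mulrA !Dal zy mulrDr mulrDl -!scalerAl !mulrA.
by rewrite addrCA.
Qed.

(** The element that makes the derivation inner commutes with the vertices. Its diagonal values
    modulo [J] are the potential, read off by comparing the multiples of an arrow modulo J^2. *)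
Lemma potential : HH1_zero B -> forall c : arrow Q -> k,
  exists lam : vertex Q -> k, forall a, c a = lam (tgt a) - lam (src a).
Proof.
move=> hh c; have [D [DM De Dal]] := weighted_derivation c.
have [|x xE] := hh D; first by move=> a b; rewrite DM addrAC subrr.
have ex i : e i * x = x * e i.
  by apply/eqP; rewrite -subr_eq0 -xE De.
have /fin_all_exists[lam lamP] i := pres_diag P i x; exists lam => a.
apply/eqP; rewrite eq_sym -subr_eq0; apply/eqP.
have key : (lam (tgt a) - lam (src a) - c a) *: al a \in (J * J)%VS.
  have -> : (lam (tgt a) - lam (src a) - c a) *: al a =
      (e (src a) * x * e (src a) - lam (src a) *: e (src a)) * al a
      - al a * (e (tgt a) * x * e (tgt a) - lam (tgt a) *: e (tgt a)).
    have -> : (e (src a) * x * e (src a) - lam (src a) *: e (src a)) * al a =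
        x * al a - lam (src a) *: al a.
      by rewrite mulrBl -scalerAl ex -!mulrA !(pres_src P).
    have -> : al a * (e (tgt a) * x * e (tgt a) - lam (tgt a) *: e (tgt a)) =
        al a * x - lam (tgt a) *: al a.
      by rewrite mulrBr -scalerAr -mulrA -ex !mulrA !(pres_tgt P).
    rewrite !scalerBl -Dal xE !opprB addrACA [RHS]addrACA.
    by rewrite [x * al a + _]addrC.
  by rewrite memvB // memv_mul ?(pres_rad P).
pose c' b := if b == a then lam (tgt a) - lam (src a) - c a else 0.
suff : c' a = 0 by rewrite /c' eqxx.
apply: (pres_free P); rewrite (bigD1 a) //= big1 /c' ?eqxx ?addr0 // => b ba.
by rewrite (negPf ba) scale0r.
Qed.

(** The potential differences telescope to 0 around a cycle. The edge carrying the weight is crossed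
    once, so the sum is also 1 or -1, which is nonzero in every characteristic. *)
Lemma no_cycle : HH1_zero B -> forall cs : seq (dart Q), ~ graph_cycle cs.
Proof.
move=> hh [|d ds] [] //= _ cyc _ /andP[dds _].
have [lam lamE] := potential hh (fun a => (a == d.1)%:R).
pose w (d' : dart Q) := lam (dart_tgt d') - lam (dart_src d').
have tgts d1 s : path (fun d d' => dart_tgt d == dart_src d') d1 s ->
    map (@dart_tgt Q) (belast d1 s) = map (@dart_src Q) s.
  by elim: s d1 => [//|d2 s IHs] d1 /= /andP[/eqP -> /IHs ->].
have w0 : \sum_(d' <- d :: ds) w d' = 0.
  have big_dart (f : dart Q -> vertex Q) :
      \sum_(d' <- d :: ds) lam (f d') = \sum_(v <- map f (d :: ds)) lam v.
    by rewrite big_map.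
  rewrite sumrB !big_dart; have := tgts _ _ cyc; rewrite belast_rcons => ->.
  rewrite (perm_big (map (@dart_src Q) (d :: ds))) ?subrr //.
  by apply: perm_map; rewrite perm_rcons.
have wE d' : w d' = (-1) ^+ (~~ d'.2) * (d'.1 == d.1)%:R.
  rewrite lamE /w /dart_tgt /dart_src; case: d'.2; first by rewrite mul1r.
  by rewrite mulN1r opprB.
move: w0; rewrite big_cons big_seq big1 ?addr0 => [|d' d'ds].
  by rewrite wE eqxx mulr1 => /eqP; rewrite signr_eq0.
rewrite wE; case: eqP => [d1|_]; last by rewrite mulr0.
by case/mapP: dds; exists d'.
Qed.

End Hereditary.

Theorem theorem5p11 (k : closedFieldType) (B : falgType k) (Q : quiver)
    (B_basic : basic_algebra B) (B_connected : connected_algebra B)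
    (B_cluster_tilted : cluster_tilted B) (Q_ordinary : is_ordinary_quiver B Q) :
  HH1_zero B <-> hereditary B /\ is_tree Q.
Proof.
have [e [al [J P]]] := ordinary_presentation B_basic Q_ordinary.
split=> [hh|[_ treeQ]]; last exact: tree_HH1 P treeQ.
have herB := cluster_tilted_hereditary B_cluster_tilted hh; split=> //; split.
- rewrite lt0n; apply/negP => /eqP/card0_eq V0.
  have := pres_sum P; rewrite big_pred0 => [/esym/eqP|i]; last exact: V0.
  by rewrite oner_eq0.
- exact: connected_quiver P B_connected.
- exact: no_cycle P herB hh.
Qed.
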